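(* Let $E$ be a row-finite graph and $K$ a field. There is a bijection $$\mathcal{M}(E)\ \cup\ \bigl(\mathcal{M}_\tau(E)\times \mathrm{Spec}(K[x,x^{-1}])^*\bigr)\ \longleftrightarrow\ \mathrm{Spec}(L_K(E)),$$ where the union on the left is a disjoint union.
   Context: A (directed) graph $E=(E^0,E^1,r,s)$ consists of countable (finite or countably infinite) sets $E^0$ (vertices), $E^1$ (edges) and maps $r,s:E^1\to E^0$ (range, source). It is row-finite if $s^{-1}(v)$ is finite for every $v\in E^0$; all graphs are row-finite. A path is either a vertex $v$ (length $0$, with source and range $v$) or a sequence $\mu=e_1\dots e_n$ of edges with $r(e_i)=s(e_{i+1})$; $s(\mu)=s(e_1)$, $r(\mu)=r(e_n)$, and $\mu^0$ denotes its set of vertices. The Leavitt path algebra $L_K(E)$ is the (associative, not necessarily unital) $K$-algebra generated by pairwise orthogonal idempotents $\{v\mid v\in E^0\}$ and elements $\{e,e^*\mid e\in E^1\}$ subject to: $s(e)e=er(e)=e$; $r(e)e^*=e^*s(e)=e^*$; $e^*e'=\delta_{e,e'}r(e)$ for $e,e'\in E^1$; $v=\sum_{\{e\in E^1\mid s(e)=v\}}ee^*$ for every $v\in E^0$ that emits edges. Write $v\ge w$ if there is a path with source $v$ and range $w$. A nonempty subset $M\subseteq E^0$ is a maximal tail if: (MT1) if $v\in E^0$, $w\in M$ and $v\ge w$, then $v\in M$; (MT2) if $v\in M$ with $s^{-1}(v)\neq\emptyset$, there is $e\in E^1$ with $s(e)=v$ and $r(e)\in M$; (MT3) for every $v,w\in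 M$ there is $y\in M$ with $v\ge y$ and $w\ge y$. $\mathcal{M}(E)$ is the set of maximal tails of $E$. An edge $e$ is an exit for a path $e_1\dots e_n$ if there is $i$ with $s(e)=s(e_i)$ and $e\ne e_i$. For $M\subseteq E^0$, a path in $M$ is a path $\alpha$ of $E$ with $\alpha^0\subseteq M$; it has an exit in $M$ if it has an exit $e$ with $r(e)\in M$. A closed simple path based at $v$ is a path $e_1\dots e_n$ ($n\ge1$) with $s(e_1)=r(e_n)=v$ and $s(e_j)\ne v$ for $j>1$. $\mathcal{M}_\gamma(E)$ is the set of maximal tails $M$ such that every closed simple path in $M$ has an exit in $M$, and $\mathcal{M}_\tau(E)=\mathcal{M}(E)\setminus\mathcal{M}_\gamma(E)$. $\mathrm{Spec}(A)$ is the set of all prime (proper, two-sided) ideals of $A$, and $\mathrm{Spec}(A)^*=\mathrm{Spec}(A)\setminus\{0\}$. *)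

(* Defs.v *)
From HB Require Import structures.
From mathcomp Require Import all_boot all_order all_algebra.
From mathcomp Require Import boolp classical_sets functions cardinality.

Set Implicit Arguments.
Unset Strict Implicit.
Unset Printing Implicit Defensive.

Import GRing.Theory.

Local Open Scope ring_scope.
Local Open Scope classical_set_scope.
Local Open Scope quotient_scope.

HB.mixin Record Zmodule_isNonUnitalRing R of GRing.Zmodule R := {
  nmul : R -> R -> R;
  nmulA : associative nmul;
  nmulDl : left_distributive nmul +%R;
  nmulDr : right_distributive nmul +%R
}.

#[short(type="nonUnitalRingType")]
HB.structure Definition NonUnitalRing :=
  {R of Zmodule_isNonUnitalRing R & GRing.Zmodule R}.

(* Ideals are ring ideals. In a Leavitt path algebra they are automatically
   K-subspaces, since the algebra has local units. *)
Section PrimeIdeals.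
Variable R : nonUnitalRingType.

Definition two_sided_ideal (I : set R) : Prop :=
  [/\ I 0, forall a b, I a -> I b -> I (a - b),
      forall r a, I a -> I (nmul r a) & forall r a, I a -> I (nmul a r)].

Definition prime_ideal (P : set R) : Prop :=
  [/\ two_sided_ideal P, P != [set: R] &
      forall I J : set R, two_sided_ideal I -> two_sided_ideal J ->
        (forall a b, I a -> J b -> P (nmul a b)) -> I `<=` P \/ J `<=` P].

Definition Spec : set (set R) := [set P | prime_ideal P].

Definition SpecStar : set (set R) := Spec `\` [set [set 0]].

End PrimeIdeals.

Arguments Spec R : clear implicits.
Arguments SpecStar R : clear implicits.

(* K[x, x^-1] is the subring of K(x) formed by the fractions p / x^n. *)
Section Laurent.
Variable K : fieldType.

Local Notation "p %:F" := (tofrac p).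

Definition laurent_pred : {pred {fraction {poly K}}} :=
  fun f => `[< exists (p : {poly K}) (n : nat), f = p%:F / ('X : {poly K})%:F ^+ n >].

Let tofracX_neq0 : ('X : {poly K})%:F != 0.
Proof. by rewrite tofrac_eq0 polyX_eq0. Qed.

Lemma laurent_subring_closed : subring_closed laurent_pred.
Proof.
split=> [|f g /asboolP[p [n ->]] /asboolP[q [m ->]]
         |f g /asboolP[p [n ->]] /asboolP[q [m ->]]]; apply/asboolP.
- by exists 1, 0%N; rewrite tofrac1 expr0 divr1.
- exists (p * 'X^m - q * 'X^n), (n + m)%N.
  by rewrite tofracB !tofracM !tofracXn -mulNr addf_div ?expf_neq0// exprD mulNr.
- by exists (p * q), (n + m)%N; rewrite tofracM exprD mulf_div.
Qed.

HB.instance Definition _ :=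
  GRing.isSubringClosed.Build _ laurent_pred laurent_subring_closed.

Record laurent :=
  Laurent { laurent_val : {fraction {poly K}}; _ : laurent_val \in laurent_pred }.

HB.instance Definition _ := [isSub for laurent_val].
HB.instance Definition _ := [Choice of laurent by <:].
HB.instance Definition _ := [SubChoice_isSubComNzRing of laurent by <:].
HB.instance Definition _ := Zmodule_isNonUnitalRing.Build laurent
  (@mulrA laurent) (@mulrDl laurent) (@mulrDr laurent).

End Laurent.

Record graph := Graph {
  vertex : countType;
  edge : countType;
  src : edge -> vertex;
  rng : edge -> vertex
}.

Definition row_finite (E : graph) : Prop :=
  forall v : vertex E, finite_set [set e | src e = v].

(* Expressions in the generators v, e, e^*. The algebra is the quotient of the
   expressions by the least congruence that contains the axioms of an
   associative, not necessarily unital, K-algebra and the defining relations. *)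

Inductive lpa_term (K : Type) (E : graph) : Type :=
| TVertex of vertex E
| TEdge of edge E
| TGhost of edge E
| TZero
| TAdd of lpa_term K E & lpa_term K E
| TScale of K & lpa_term K E
| TMul of lpa_term K E & lpa_term K E.

Arguments TVertex {K E}.
Arguments TEdge {K E}.
Arguments TGhost {K E}.
Arguments TZero {K E}.

HB.instance Definition _ (K : Type) (E : graph) := gen_eqMixin (lpa_term K E).
HB.instance Definition _ (K : Type) (E : graph) := gen_choiceMixin (lpa_term K E).

Inductive lpa_eq (K : fieldType) (E : graph) :
    lpa_term K E -> lpa_term K E -> Prop :=
| lpa_refl a : lpa_eq a a
| lpa_sym a b : lpa_eq a b -> lpa_eq b a
| lpa_trans a b c : lpa_eq a b -> lpa_eq b c -> lpa_eq a c
| lpa_congD a a' b b' :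
    lpa_eq a a' -> lpa_eq b b' -> lpa_eq (TAdd a b) (TAdd a' b')
| lpa_congZ k a a' : lpa_eq a a' -> lpa_eq (TScale k a) (TScale k a')
| lpa_congM a a' b b' :
    lpa_eq a a' -> lpa_eq b b' -> lpa_eq (TMul a b) (TMul a' b')
| lpa_addA a b c : lpa_eq (TAdd a (TAdd b c)) (TAdd (TAdd a b) c)
| lpa_addC a b : lpa_eq (TAdd a b) (TAdd b a)
| lpa_add0 a : lpa_eq (TAdd TZero a) a
| lpa_addN a : lpa_eq (TAdd (TScale (-1) a) a) TZero
| lpa_scaleA k l a : lpa_eq (TScale k (TScale l a)) (TScale (k * l) a)
| lpa_scale1 a : lpa_eq (TScale 1 a) a
| lpa_scaleDr k a b :
    lpa_eq (TScale k (TAdd a b)) (TAdd (TScale k a) (TScale k b))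
| lpa_scaleDl k l a :
    lpa_eq (TScale (k + l) a) (TAdd (TScale k a) (TScale l a))
| lpa_mulA a b c : lpa_eq (TMul a (TMul b c)) (TMul (TMul a b) c)
| lpa_mulDl a b c : lpa_eq (TMul (TAdd a b) c) (TAdd (TMul a c) (TMul b c))
| lpa_mulDr a b c : lpa_eq (TMul a (TAdd b c)) (TAdd (TMul a b) (TMul a c))
| lpa_scaleAl k a b : lpa_eq (TScale k (TMul a b)) (TMul (TScale k a) b)
| lpa_scaleAr k a b : lpa_eq (TScale k (TMul a b)) (TMul a (TScale k b))
| lpa_vertex_idem v : lpa_eq (TMul (TVertex v) (TVertex v)) (TVertex v)
| lpa_vertex_orth v w : v != w -> lpa_eq (TMul (TVertex v) (TVertex w)) TZero
| lpa_src_edge e : lpa_eq (TMul (TVertex (src e)) (TEdge e)) (TEdge e)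
| lpa_edge_rng e : lpa_eq (TMul (TEdge e) (TVertex (rng e))) (TEdge e)
| lpa_rng_ghost e : lpa_eq (TMul (TVertex (rng e)) (TGhost e)) (TGhost e)
| lpa_ghost_src e : lpa_eq (TMul (TGhost e) (TVertex (src e))) (TGhost e)
| lpa_CK1 e : lpa_eq (TMul (TGhost e) (TEdge e)) (TVertex (rng e))
| lpa_CK1_orth e f : e != f -> lpa_eq (TMul (TGhost e) (TEdge f)) TZero
| lpa_CK2 v (es : seq (edge E)) :
    (* es enumerates s^-1(v), which is nonempty, without repetition *)
    uniq es -> es != [::] -> (forall e, (e \in es) = (src e == v)) ->
    lpa_eq (TVertex v)
      (foldr (fun e a => TAdd (TMul (TEdge e) (TGhost e)) a) TZero es).

Section LeavittPathAlgebra.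
Variables (K : fieldType) (E : graph).

Definition lpa_eqb : rel (lpa_term K E) := fun a b => `[< lpa_eq a b >].

Lemma lpa_eqb_equiv : equiv_class_of lpa_eqb.
Proof.
split=> [a|a b|b a c].
- exact/asboolP/lpa_refl.
- by apply/asboolP/asboolP; apply: lpa_sym.
- by move=> /asboolP ab /asboolP bc; apply/asboolP/(lpa_trans ab bc).
Qed.

Canonical lpa_equiv := EquivRelPack lpa_eqb_equiv.

Definition leavitt := {eq_quot lpa_eqb}.

HB.instance Definition _ := Choice.on leavitt.
HB.instance Definition _ := EqQuotient.on leavitt.

Definition lpa_class (a : lpa_term K E) : leavitt := \pi_leavitt a.

Lemma lpa_classP a b : lpa_class a = lpa_class b <-> lpa_eq a b.
Proof. by split=> [/eqmodP/asboolP //|ab]; apply/eqmodP/asboolP. Qed.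

Lemma lpa_classW (P : leavitt -> Prop) :
  (forall a, P (lpa_class a)) -> forall x, P x.
Proof. by move=> Pclass; apply: quotW. Qed.

Definition lpa_add (x y : leavitt) := lpa_class (TAdd (repr x) (repr y)).
Definition lpa_scale (k : K) (x : leavitt) := lpa_class (TScale k (repr x)).
Definition lpa_mul (x y : leavitt) := lpa_class (TMul (repr x) (repr y)).

Lemma lpa_repr_class a : lpa_eq (repr (lpa_class a)) a.
Proof. by apply/lpa_classP; rewrite /lpa_class reprK. Qed.

Lemma lpa_class_add a b :
  lpa_add (lpa_class a) (lpa_class b) = lpa_class (TAdd a b).
Proof. by apply/lpa_classP/lpa_congD; apply: lpa_repr_class. Qed.

Lemma lpa_class_scale k a :
  lpa_scale k (lpa_class a) = lpa_class (TScale k a).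
Proof. exact/lpa_classP/lpa_congZ/lpa_repr_class. Qed.

Lemma lpa_class_mul a b :
  lpa_mul (lpa_class a) (lpa_class b) = lpa_class (TMul a b).
Proof. by apply/lpa_classP/lpa_congM; apply: lpa_repr_class. Qed.

Fact leavitt_addA : associative lpa_add.
Proof.
elim/lpa_classW=> a; elim/lpa_classW=> b; elim/lpa_classW=> c.
rewrite (lpa_class_add b c) (lpa_class_add a b) 2!lpa_class_add.
exact/lpa_classP/lpa_addA.
Qed.

Fact leavitt_addC : commutative lpa_add.
Proof.
elim/lpa_classW=> a; elim/lpa_classW=> b.
by rewrite 2!lpa_class_add; apply/lpa_classP/lpa_addC.
Qed.

Fact leavitt_add0 : left_id (lpa_class TZero) lpa_add.
Proof.
by elim/lpa_classW=> a; rewrite lpa_class_add; apply/lpa_classP/lpa_add0.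
Qed.

Fact leavitt_addN : left_inverse (lpa_class TZero) (lpa_scale (-1)) lpa_add.
Proof.
elim/lpa_classW=> a; rewrite (lpa_class_scale _ a) lpa_class_add.
exact/lpa_classP/lpa_addN.
Qed.

HB.instance Definition _ := GRing.isZmodule.Build leavitt
  leavitt_addA leavitt_addC leavitt_add0 leavitt_addN.

Fact leavitt_scaleA k l x : lpa_scale k (lpa_scale l x) = lpa_scale (k * l) x.
Proof.
elim/lpa_classW: x => a; rewrite (lpa_class_scale l a) 2!lpa_class_scale.
exact/lpa_classP/lpa_scaleA.
Qed.

Fact leavitt_scale1 : left_id 1 lpa_scale.
Proof.
by elim/lpa_classW=> a; rewrite lpa_class_scale; apply/lpa_classP/lpa_scale1.
Qed.

Fact leavitt_scaleDr : right_distributive lpa_scale +%R.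
Proof.
move=> k; elim/lpa_classW=> a; elim/lpa_classW=> b; rewrite /GRing.add/=.
rewrite (lpa_class_add a b) (lpa_class_scale k a) (lpa_class_scale k b).
by rewrite lpa_class_scale lpa_class_add; apply/lpa_classP/lpa_scaleDr.
Qed.

Fact leavitt_scaleDl x : {morph lpa_scale^~ x : k l / k + l}.
Proof.
elim/lpa_classW: x => a k l; rewrite [RHS]/GRing.add/=.
rewrite (lpa_class_scale k a) (lpa_class_scale l a).
by rewrite lpa_class_scale lpa_class_add; apply/lpa_classP/lpa_scaleDl.
Qed.

HB.instance Definition _ := GRing.Zmodule_isLmodule.Build K leavitt
  leavitt_scaleA leavitt_scale1 leavitt_scaleDr leavitt_scaleDl.

Fact leavitt_mulA : associative lpa_mul.
Proof.
elim/lpa_classW=> a; elim/lpa_classW=> b; elim/lpa_classW=> c.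
rewrite (lpa_class_mul b c) (lpa_class_mul a b) 2!lpa_class_mul.
exact/lpa_classP/lpa_mulA.
Qed.

Fact leavitt_mulDl : left_distributive lpa_mul +%R.
Proof.
elim/lpa_classW=> a; elim/lpa_classW=> b; elim/lpa_classW=> c.
rewrite /GRing.add/= (lpa_class_add a b) (lpa_class_mul a c).
rewrite (lpa_class_mul b c) lpa_class_mul lpa_class_add.
exact/lpa_classP/lpa_mulDl.
Qed.

Fact leavitt_mulDr : right_distributive lpa_mul +%R.
Proof.
elim/lpa_classW=> a; elim/lpa_classW=> b; elim/lpa_classW=> c.
rewrite /GRing.add/= (lpa_class_add b c) (lpa_class_mul a b).
rewrite (lpa_class_mul a c) lpa_class_mul lpa_class_add.
exact/lpa_classP/lpa_mulDr.
Qed.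

HB.instance Definition _ := Zmodule_isNonUnitalRing.Build leavitt
  leavitt_mulA leavitt_mulDl leavitt_mulDr.

Lemma leavitt_scaleAl (k : K) (x y : leavitt) :
  k *: nmul x y = nmul (k *: x) y.
Proof.
elim/lpa_classW: x => a; elim/lpa_classW: y => b.
rewrite /nmul/GRing.scale/= (lpa_class_mul a b) (lpa_class_scale k a).
by rewrite lpa_class_scale lpa_class_mul; apply/lpa_classP/lpa_scaleAl.
Qed.

Lemma leavitt_scaleAr (k : K) (x y : leavitt) :
  k *: nmul x y = nmul x (k *: y).
Proof.
elim/lpa_classW: x => a; elim/lpa_classW: y => b.
rewrite /nmul/GRing.scale/= (lpa_class_mul a b) (lpa_class_scale k b).
by rewrite lpa_class_scale lpa_class_mul; apply/lpa_classP/lpa_scaleAr.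
Qed.

End LeavittPathAlgebra.

Section MaximalTails.
Variable E : graph.
Implicit Types (v w y : vertex E) (e f : edge E) (p : seq (edge E)).
Implicit Types M : set (vertex E).

(* The path of positive length e_1 ... e_n is the list e :: p with e = e_1. *)
Definition is_path e p : bool := path (fun f g => rng f == src g) e p.

Definition connects v w : Prop :=
  v = w \/ exists e p, [/\ is_path e p, src e = v & rng (last e p) = w].

Definition maximal_tail M : Prop :=
  [/\ M !=set0,
      forall v w, M w -> connects v w -> M v,
      forall v, M v -> (exists e, src e = v) -> exists e, src e = v /\ M (rng e) &
      forall v w, M v -> M w -> exists y, [/\ M y, connects v y & connects w y]].

Definition path_in M e p : Prop :=
  is_path e p /\ forall f, f \in e :: p -> M (src f) /\ M (rng f).

Definition is_exit f e p : Prop :=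
  exists2 g, g \in e :: p & src f = src g /\ f <> g.

Definition has_exit_in M e p : Prop := exists f, is_exit f e p /\ M (rng f).

Definition closed_simple_path v e p : Prop :=
  [/\ is_path e p, src e = v, rng (last e p) = v &
      forall f, f \in p -> src f <> v].

Definition max_tails : set (set (vertex E)) := [set M | maximal_tail M].

Definition max_tails_gamma : set (set (vertex E)) :=
  [set M | maximal_tail M /\
     forall v e p, closed_simple_path v e p -> path_in M e p -> has_exit_in M e p].

Definition max_tails_tau : set (set (vertex E)) := max_tails `\` max_tails_gamma.

End MaximalTails.

Arguments max_tails E : clear implicits.
Arguments max_tails_gamma E : clear implicits.
Arguments max_tails_tau E : clear implicits.

(* Main.v *)
Require Import Defs.
From HB Require Import structures.
From mathcomp Require Import all_boot all_order all_algebra.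
From mathcomp Require Import boolp classical_sets functions cardinality.
From mathcomp Require Import zify.

(** A prime ideal [P] of L_K(E) is compared with the set [tail_of P] of the
   vertices outside [P].  This set is a maximal tail ([prime_tail]): (MT1) holds
   for every ideal, (MT2) follows from the expression of a vertex by the edges
   that it emits, and (MT3) is primeness applied to two vertices [v] and [w],
   because v L w is spanned by the products of a path from [v] and the ghost of
   a path from [w] with the same range.  It remains to count the primes with a
   given tail [M].

   If every closed path in [M] has an exit in [M], there is exactly one
   ([gamma_prime]).  The point is that an ideal [P] without vertices of [M] lies
   in every ideal [J] containing the other vertices ([ideal_sub]).  An element of
   [P] outside [J] can be multiplied on the right until ghost edges disappear,
   then on the left by the ghost of a shortest path, which produces in [P] a
   multiple of a vertex of [M] plus a combination of closed paths.  Conjugation by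
   a path that leaves a closed path through an exit kills this closed path, and
   after finitely many steps a vertex of [M] is found in [P].  Existence comes
   from a representation of L_K(E) that kills exactly the vertices outside [M].
   It acts on functions on E^0 x nat; at a vertex of [M] that emits edges, the
   copy of nat is identified with the disjoint union of the copies at the ends of
   the edges that lead into [M].

   Otherwise [M] contains a cycle without exits in [M], based at [v] say, to which
   all of [M] is connected.  A path in [M] from [v] can only follow this cycle, so
   modulo the vertices outside [M] the corner v L v consists of the Laurent
   polynomials in the cycle ([corner_poly]).  That there are no further relations
   is seen on the same representation, now over K[x, x^-1] and with weight [x] on
   the cycle: a matrix coefficient defines a surjective map [eval] from the corner
   to K[x, x^-1], whose kernel lies in every prime with tail [M]
   ([eval_kernel]).  As a prime not containing [v] is determined by its corner,
   the primes with tail [M] correspond to all the primes of K[x, x^-1]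
   ([tau_primes]).  The zero ideal corresponds to [M] as an element of the first
   summand, and the nonzero primes give the second summand. *)

Set Implicit Arguments.
Unset Strict Implicit.
Unset Printing Implicit Defensive.

Import GRing.Theory.

Local Open Scope ring_scope.
Local Open Scope classical_set_scope.

Local Notation "x ** y" := (nmul x y) (at level 40, left associativity).

(** * Ideals of rings without identity *)

Section NonUnital.
Variable A : nonUnitalRingType.
Implicit Types (a b c x y : A) (P I : set A).

Lemma nmul0l a : 0 ** a = 0.
Proof. by apply: (addIr (0 ** a)); rewrite -nmulDl !add0r. Qed.

Lemma nmul0r a : a ** 0 = 0.
Proof. by apply: (addIr (a ** 0)); rewrite -nmulDr !add0r. Qed.

Lemma nmulNl a b : (- a) ** b = - (a ** b).
Proof. by apply: (addIr (a ** b)); rewrite -nmulDl !addNr nmul0l. Qed.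

Lemma nmulNr a b : a ** (- b) = - (a ** b).
Proof. by apply: (addIr (a ** b)); rewrite -nmulDr !addNr nmul0r. Qed.

Lemma nmulBl a b c : (a - b) ** c = a ** c - b ** c.
Proof. by rewrite nmulDl nmulNl. Qed.

Lemma nmulBr a b c : a ** (b - c) = a ** b - a ** c.
Proof. by rewrite nmulDr nmulNr. Qed.

Lemma nmul_suml (T : Type) (s : seq T) (Q : pred T) (F : T -> A) a :
  (\sum_(i <- s | Q i) F i) ** a = \sum_(i <- s | Q i) F i ** a.
Proof.
exact: (big_morph (fun x => x ** a) (fun x y => nmulDl x y a) (nmul0l a)).
Qed.

Lemma nmul_sumr (T : Type) (s : seq T) (Q : pred T) (F : T -> A) a :
  a ** (\sum_(i <- s | Q i) F i) = \sum_(i <- s | Q i) a ** F i.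
Proof. exact: (big_morph (fun x => a ** x) (nmulDr a) (nmul0r a)). Qed.

Section IdealClosure.
Variable P : set A.
Hypothesis iP : two_sided_ideal P.

Lemma ideal0 : P 0. Proof. by case: iP. Qed.

Lemma idealB a b : P a -> P b -> P (a - b).
Proof. by case: iP => _ + _ _; apply. Qed.

Lemma idealN a : P a -> P (- a).
Proof. by rewrite -[- a]sub0r; apply/idealB/ideal0. Qed.

Lemma idealD a b : P a -> P b -> P (a + b).
Proof. by move=> Pa Pb; rewrite -[b]opprK; apply/idealB/idealN. Qed.

Lemma ideal_mull r a : P a -> P (r ** a).
Proof. by case: iP => _ _ + _; apply. Qed.

Lemma ideal_mulr r a : P a -> P (a ** r).
Proof. by case: iP => _ _ _; apply. Qed.

Lemma ideal_sum (T : eqType) (s : seq T) (Q : pred T) (F : T -> A) :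
  (forall i, i \in s -> Q i -> P (F i)) -> P (\sum_(i <- s | Q i) F i).
Proof.
move=> PF; rewrite big_seq_cond; apply: big_ind; [exact: ideal0|exact: idealD|].
by move=> i /andP[]; apply: PF.
Qed.

Lemma idealBD a b : P (a - b) -> P b -> P a.
Proof. by move=> Pab Pb; rewrite -[a](subrK b); apply: idealD. Qed.

Lemma ideal_congl a b : P (a - b) -> P a -> P b.
Proof. by move=> Pab Pa; rewrite -[b](subKr a); apply: idealB. Qed.

Lemma ideal_trans a b c : P (a - b) -> P (b - c) -> P (a - c).
Proof. by move=> Pab Pbc; rewrite -[a](subrK b) -addrA; apply: idealD. Qed.

End IdealClosure.



(** Without an identity, principal ideals are awkward.  The direct part uses
   annihilators modulo [P] instead: [I] is the left annihilator of [b] and [J] the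
   right annihilator of [I]. *)
Lemma prime_idealP P :
  (forall a, exists f, a = a ** f) ->
  two_sided_ideal P -> P != setT ->
  prime_ideal P <->
  (forall a b, (forall r, P (a ** r ** b)) -> P a \/ P b).
Proof.
move=> ur iP Pprop; split=> [[_ _ prP] a b ab|elt]; last first.
  split=> // I J iI iJ IJ; apply: contrapT => /not_orP[/existsNP[a]].
  move=> /not_implyP[Ia nPa] /existsNP[b /not_implyP[Jb nPb]].
  by case: (elt a b) => // r; apply: IJ => //; apply: ideal_mulr.
pose I := [set x | forall r, P (x ** r ** b)].
pose J := [set y | forall x r, I x -> P (x ** r ** y)].
have iI : two_sided_ideal I.
  split=> [r|x y Ix Iy r|s x Ix r|s x Ix r] /=.
  - by rewrite !nmul0l; apply: ideal0.
  - by rewrite !nmulBl; apply: idealB.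
  - by rewrite -[s ** x ** r]nmulA -nmulA; apply: ideal_mull.
  - by rewrite -[x ** s ** r]nmulA.
have iJ : two_sided_ideal J.
  split=> [x r _|y z Jy Jz x r Ix|s y Jy x r Ix|s y Jy x r Ix] /=.
  - by rewrite nmul0r; apply: ideal0.
  - by rewrite nmulBr; apply: idealB; [|apply: Jy|apply: Jz].
  - by rewrite nmulA -[x ** r ** s]nmulA; apply: Jy.
  - by rewrite nmulA; apply: ideal_mulr => //; apply: Jy.
have [|IP|JP] := prP I J iI iJ.
- by move=> x y Ix Jy; have [f xf] := ur x; rewrite xf; apply: Jy.
- by left; apply: IP.
- by right; apply: JP => x r; apply.
Qed.

End NonUnital.

(** * Paths and their monomials *)

Section Paths.
Variable E : graph.
Implicit Types (v w u : vertex E) (e f : edge E) (s t q : seq (edge E)).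

(** A path is encoded by its source [v] and its list of edges [s], so that the
   paths of length [0] need no separate treatment. *)
Fixpoint walk v s : bool :=
  if s is e :: s' then (src e == v) && walk (rng e) s' else true.

Definition target v s := last v (map (@rng E) s).

Lemma target_cat v s t : target v (s ++ t) = target (target v s) t.
Proof. by rewrite /target map_cat last_cat. Qed.

Lemma walk_cat v s t : walk v (s ++ t) = walk v s && walk (target v s) t.
Proof. by elim: s v => //= e s IH v; rewrite IH andbA. Qed.

Lemma walk_rcons v s e : walk v (rcons s e) = walk v s && (src e == target v s).
Proof. by rewrite -cats1 walk_cat /= andbT. Qed.

Lemma target_rcons v s e : target v (rcons s e) = rng e.
Proof. by rewrite /target map_rcons last_rcons. Qed.

Lemma walk_is_path e s : walk (src e) (e :: s) = is_path e s.
Proof.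
by rewrite /= eqxx /is_path; elim: s e => //= f s IH e; rewrite IH eq_sym.
Qed.

Lemma connectsP v w : connects v w <-> exists2 s, walk v s & target v s = w.
Proof.
split=> [[->|[e [s [es <- ew]]]]|[[|e s] /= es <-]].
- by exists [::].
- by exists (e :: s); rewrite ?walk_is_path // /target /= last_map.
- by left.
- have /andP[/eqP se _] := es; right; exists e, s.
  split=> //; first by rewrite -walk_is_path /= eqxx; case/andP: es.
  by rewrite /target /= last_map.
Qed.

Lemma connects_trans v w u : connects v w -> connects w u -> connects v u.
Proof.
move=> /connectsP[s vs <-] /connectsP[t wt <-]; apply/connectsP.
by exists (s ++ t); rewrite ?walk_cat ?vs // target_cat.
Qed.

End Paths.

Section Leavitt.
Variables (K : fieldType) (E : graph).
Local Notation L := (leavitt K E).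
Implicit Types (v w u : vertex E) (e f : edge E) (s t q : seq (edge E)).
Implicit Types (a b c x y : L) (k : K) (P : set L).

Definition vtx v : L := lpa_class (TVertex v).
Definition edg e : L := lpa_class (TEdge e).
Definition gst e : L := lpa_class (TGhost e).

Lemma class_zero : lpa_class TZero = 0 :> L.
Proof. by []. Qed.

Lemma class_add (a b : lpa_term K E) :
  lpa_class (TAdd a b) = lpa_class a + lpa_class b.
Proof. by rewrite -lpa_class_add. Qed.

Lemma class_mul (a b : lpa_term K E) :
  lpa_class (TMul a b) = lpa_class a ** lpa_class b.
Proof. by rewrite -lpa_class_mul. Qed.

Lemma class_scale k (a : lpa_term K E) :
  lpa_class (TScale k a) = k *: lpa_class a.
Proof. by rewrite -lpa_class_scale. Qed.

Lemma vtx_mul v w : vtx v ** vtx w = if v == w then vtx v else 0.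
Proof.
rewrite -class_mul -class_zero; case: eqVneq => [<-|vw]; apply/lpa_classP.
  exact: lpa_vertex_idem.
exact: lpa_vertex_orth.
Qed.

Lemma vtx_idem v : vtx v ** vtx v = vtx v.
Proof. by rewrite vtx_mul eqxx. Qed.

Lemma vtx_edg e : vtx (src e) ** edg e = edg e.
Proof. by rewrite -class_mul; apply/lpa_classP/lpa_src_edge. Qed.

Lemma edg_vtx e : edg e ** vtx (rng e) = edg e.
Proof. by rewrite -class_mul; apply/lpa_classP/lpa_edge_rng. Qed.

Lemma vtx_gst e : vtx (rng e) ** gst e = gst e.
Proof. by rewrite -class_mul; apply/lpa_classP/lpa_rng_ghost. Qed.

Lemma gst_vtx e : gst e ** vtx (src e) = gst e.
Proof. by rewrite -class_mul; apply/lpa_classP/lpa_ghost_src. Qed.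

Lemma gst_edg e f : gst e ** edg f = if e == f then vtx (rng e) else 0.
Proof.
rewrite -class_mul -class_zero; case: eqVneq => [<-|ef]; apply/lpa_classP.
  exact: lpa_CK1.
exact: lpa_CK1_orth.
Qed.

Lemma row_finite_seq v : row_finite E ->
  exists2 es : seq (edge E), uniq es & forall e, (e \in es) = (src e == v).
Proof.
move=> /(_ v)/finite_seqP[s sE]; exists (undup s); first exact: undup_uniq.
move=> e; rewrite mem_undup; apply/idP/eqP => [es|ev].
  by have : [set` s] e by []; rewrite -sE.
by have : [set e | src e = v] e by []; rewrite sE.
Qed.

Lemma vtx_sum v (es : seq (edge E)) :
  uniq es -> (forall e, (e \in es) = (src e == v)) -> es != [::] ->
  vtx v = \sum_(e <- es) edg e ** gst e.
Proof.
move=> ues esv esn; rewrite /vtx; have/lpa_classP -> := lpa_CK2 K ues esn esv.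
elim: {ues esv esn} es => [|e es IH]; first by rewrite big_nil.
by rewrite big_cons /= class_add class_mul IH.
Qed.

Lemma nmulZl k a b : (k *: a) ** b = k *: (a ** b).
Proof. by rewrite leavitt_scaleAl. Qed.

Lemma nmulZr k a b : a ** (k *: b) = k *: (a ** b).
Proof. by rewrite leavitt_scaleAr. Qed.

Fixpoint rpath v s : L := if s is e :: s' then edg e ** rpath (rng e) s' else vtx v.
Fixpoint gpath v s : L :=
  if s is e :: s' then gpath (rng e) s' ** gst e else vtx v.

Lemma rpath_src v s : walk v s -> vtx v ** rpath v s = rpath v s.
Proof.
case: s => [|e s] /=; first by rewrite vtx_idem.
by case/andP=> /eqP <- _; rewrite nmulA vtx_edg.
Qed.

Lemma rpath_tgt v s : rpath v s ** vtx (target v s) = rpath v s.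
Proof. by elim: s v => [|e s IH] v /=; rewrite ?vtx_idem // -nmulA IH. Qed.

Lemma gpath_src v s : walk v s -> gpath v s ** vtx v = gpath v s.
Proof.
case: s => [|e s] /=; first by rewrite vtx_idem.
by case/andP=> /eqP <- _; rewrite -nmulA gst_vtx.
Qed.

Lemma gpath_tgt v s : vtx (target v s) ** gpath v s = gpath v s.
Proof. by elim: s v => [|e s IH] v /=; rewrite ?vtx_idem // nmulA IH. Qed.

Lemma rpath_cat v s t :
  walk v (s ++ t) -> rpath v (s ++ t) = rpath v s ** rpath (target v s) t.
Proof.
elim: s v => [|e s IH] v /=; first by move/rpath_src->.
by case/andP=> _ /IH ->; rewrite nmulA.
Qed.

Lemma gpath_cat v s t :
  walk v (s ++ t) -> gpath v (s ++ t) = gpath (target v s) t ** gpath v s.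
Proof.
elim: s v => [|e s IH] v /=; first by move/gpath_src->.
by case/andP=> _ /IH ->; rewrite nmulA.
Qed.

Lemma gpath_rpath v s : walk v s -> gpath v s ** rpath v s = vtx (target v s).
Proof.
elim: s v => [|e s IH] v /=; first by rewrite vtx_idem.
case/andP=> _ ws; rewrite -nmulA [gst e ** _]nmulA gst_edg eqxx rpath_src //.
exact: IH.
Qed.

Lemma gpath_rpath_prefix v s t : walk v (s ++ t) ->
  gpath v s ** rpath v (s ++ t) = rpath (target v s) t.
Proof.
move=> wst; have := wst; rewrite walk_cat => /andP[ws wt].
by rewrite rpath_cat // nmulA gpath_rpath // rpath_src.
Qed.

Lemma gpath_rpath_orth v s t e f s' t' : e != f -> s = t ++ e :: s' ->
  walk v s -> walk v (t ++ f :: t') -> gpath v s ** rpath v (t ++ f :: t') = 0.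
Proof.
move=> ef -> ws wt; rewrite gpath_cat // rpath_cat //.
move: ws wt; rewrite !walk_cat => /andP[vt _] /andP[_ wf].
rewrite -nmulA [gpath v t ** _]nmulA gpath_rpath // rpath_src //=.
by rewrite -nmulA [gst e ** _]nmulA gst_edg (negPf ef) nmul0l nmul0r.
Qed.

(** The case analysis behind every product [gpath v s ** rpath v t]. *)
Lemma prefix_cases s t :
  [\/ exists q, t = s ++ q, exists q, s = t ++ q |
      exists e f q s' t', [/\ e != f, s = q ++ e :: s' & t = q ++ f :: t']].
Proof.
elim: s t => [|e s IH] [|f t]; try by constructor 1; eexists.
  by constructor 2; eexists.
case: (eqVneq e f) => [<-|ef]; last by constructor 3; exists e, f, [::], s, t.
case: (IH t) => [[q ->]|[q ->]|[e' [f' [q [s' [t' [ef -> ->]]]]]]].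
- by constructor 1; exists q.
- by constructor 2; exists q.
- by constructor 3; exists e', f', (e :: q), s', t'.
Qed.

(** The bound [n] on the lengths of the ghost paths is what [absorb_ghosts]
   descends on.  The union of these spaces is the whole algebra ([spanned]). *)
Inductive gspan (n : nat) : L -> Prop :=
| gspan0 : gspan n 0
| gspanD k v s w t b : walk v s -> walk w t -> target v s = target w t ->
    (size t <= n)%N -> gspan n b ->
    gspan n (k *: (rpath v s ** gpath w t) + b).

Lemma gspan_add n a b : gspan n a -> gspan n b -> gspan n (a + b).
Proof.
move=> + sb; elim=> [|k v s w t c vs wt st tn _ sc]; first by rewrite add0r.
by rewrite -addrA; constructor.
Qed.

Lemma gspan_scale n k a : gspan n a -> gspan n (k *: a).
Proof.
elim=> [|l v s w t c vs wt st tn _ sc]; first by rewrite scaler0; constructor.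
by rewrite scalerDr scalerA; constructor.
Qed.

Lemma gspan_mono n v s w t :
  walk v s -> walk w t -> target v s = target w t -> (size t <= n)%N ->
  gspan n (rpath v s ** gpath w t).
Proof.
move=> vs wt st tn; rewrite -[_ ** _]addr0 -[_ ** _]scale1r.
by constructor=> //; constructor.
Qed.

Lemma gspan_rpath n v s : walk v s -> gspan n (rpath v s).
Proof.
by move=> vs; rewrite -rpath_tgt; apply: (@gspan_mono _ v s (target v s) [::]).
Qed.

Lemma gspan_linear n m (g : L -> L) :
  {morph g : x y / x + y} -> (forall k x, g (k *: x) = k *: g x) ->
  (forall v s w t, walk v s -> walk w t -> target v s = target w t ->
     (size t <= n)%N -> gspan m (g (rpath v s ** gpath w t))) ->
  forall a, gspan n a -> gspan m (g a).
Proof.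
move=> gD gZ gm a; elim=> [|k v s w t b vs wt st tn _ sb].
  by rewrite -(scale0r 0) gZ scale0r; constructor.
by rewrite gD gZ; apply/gspan_add/sb/gspan_scale/gm.
Qed.

Lemma gspan_le n m a : (n <= m)%N -> gspan n a -> gspan m a.
Proof.
move=> nm; apply: (gspan_linear (g := id)) => // v s w t vs wt st tn.
by apply: gspan_mono => //; apply: leq_trans nm.
Qed.

Lemma mul_linear b :
  {morph nmul b : x y / x + y} /\ (forall k x, b ** (k *: x) = k *: (b ** x)).
Proof. by split=> [x y|k x]; rewrite ?nmulDr ?nmulZr. Qed.

Lemma mulr_linear b :
  {morph nmul^~ b : x y / x + y} /\ (forall k x, (k *: x) ** b = k *: (x ** b)).
Proof. by split=> [x y|k x]; rewrite ?nmulDl ?nmulZl. Qed.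

Lemma vtx_rpath u v s : walk v s ->
  vtx u ** rpath v s = if u == v then rpath v s else 0.
Proof.
move=> vs; rewrite -{1}rpath_src // nmulA vtx_mul.
by case: eqVneq => [->|]; rewrite ?rpath_src // nmul0l.
Qed.

Lemma gpath_vtx u v s : walk v s ->
  gpath v s ** vtx u = if v == u then gpath v s else 0.
Proof.
move=> vs; rewrite -{1}gpath_src // -nmulA vtx_mul.
by case: eqVneq => _; rewrite ?gpath_src // nmul0r.
Qed.

Lemma gspan_gst n e v s w t : walk v s -> walk w t -> target v s = target w t ->
  (size t <= n)%N -> gspan n.+1 (gst e ** (rpath v s ** gpath w t)).
Proof.
case: s => [|f s] /= vs wt st tn; rewrite nmulA.
  have vt : v = target w t := st; subst v.
  rewrite -[gst e]gst_vtx -[gst e ** _ ** _]nmulA vtx_mul.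
  case: eqVneq => [ve|_]; last by rewrite nmul0r nmul0l; constructor.
  have wte : walk w (rcons t e) by rewrite walk_rcons wt ve eqxx.
  have -> : gst e ** vtx (src e) ** gpath w t = gpath w (rcons t e).
    by rewrite gst_vtx -cats1 gpath_cat ?cats1 //= vtx_gst.
  rewrite -gpath_tgt; apply: (@gspan_mono _ (target w (rcons t e)) [::]) => //.
  by rewrite size_rcons.
case/andP: vs => _ vs; rewrite nmulA gst_edg.
case: eqVneq => [->|_]; last by rewrite !nmul0l; constructor.
by rewrite rpath_src //; apply: gspan_mono => //; apply: leqW.
Qed.

Lemma gspan_edg n e v s w t : walk v s -> walk w t -> target v s = target w t ->
  (size t <= n)%N -> gspan n (edg e ** (rpath v s ** gpath w t)).
Proof.
move=> vs wt st tn.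
rewrite nmulA -[edg e]edg_vtx -[_ ** rpath v s]nmulA vtx_rpath //.
case: eqVneq => [ev|_]; last by rewrite nmul0r nmul0l; constructor.
subst v; apply: (@gspan_mono _ (src e) (e :: s)) => //=; by rewrite eqxx.
Qed.

Lemma gspan_vtx n u v s w t : walk v s -> walk w t -> target v s = target w t ->
  (size t <= n)%N -> gspan n (vtx u ** (rpath v s ** gpath w t)).
Proof.
move=> vs wt st tn; rewrite nmulA vtx_rpath //.
case: eqVneq => [_|_]; first exact: gspan_mono.
by rewrite nmul0l; constructor.
Qed.

(** The union of the spaces [gspan n] is stable under left multiplication by the
   generators, hence by every element. *)
Lemma spanned a : exists n, gspan n a.
Proof.
suff /(_ a)[] : forall a, (exists n, gspan n a) /\
    forall n b, gspan n b -> exists m, gspan m (a ** b) by [].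
move=> {}a; elim/lpa_classW: a.
elim=> [v|e|e||a [[n sa] ma] b [[m sb] mb]|k a [[n sa] ma]
  |a [[n sa] ma] b [[m sb] mb]].
- split; first by exists 0%N; apply: (@gspan_rpath 0 v [::]).
  move=> n b sb; exists n; have [mD mZ] := mul_linear (vtx v).
  by apply: (gspan_linear mD mZ) sb => *; apply: gspan_vtx.
- split; first by exists 0%N; rewrite -[X in gspan _ X]edg_vtx;
    apply: (@gspan_rpath 0 (src e) [:: e]); rewrite /= eqxx.
  move=> n b sb; exists n; have [mD mZ] := mul_linear (edg e).
  by apply: (gspan_linear mD mZ) sb => *; apply: gspan_edg.
- split.
    exists 1%N; rewrite -[X in gspan _ X]gst_vtx.
    have := @gspan_gst 0 e (src e) [::] (src e) [::].
    by rewrite /= vtx_idem; apply.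
  move=> n b sb; exists n.+1; have [mD mZ] := mul_linear (gst e).
  by apply: (gspan_linear mD mZ) sb => *; apply: gspan_gst.
- split; first by exists 0%N; constructor.
  by move=> n b _; exists 0%N; rewrite nmul0l; constructor.
- split.
    exists (maxn n m); rewrite class_add.
    by apply: gspan_add;
      [apply: gspan_le sa; apply: leq_maxl|apply: gspan_le sb; apply: leq_maxr].
  move=> p c sc; have [n' sac] := ma _ _ sc; have [m' sbc] := mb _ _ sc.
  exists (maxn n' m'); rewrite class_add nmulDl.
  by apply: gspan_add;
    [apply: gspan_le sac; apply: leq_maxl|apply: gspan_le sbc; apply: leq_maxr].
- split; first by exists n; rewrite class_scale; apply: gspan_scale.
  move=> p c sc; have [n' sac] := ma _ _ sc; exists n'.
  by rewrite class_scale nmulZl; apply: gspan_scale.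
- split; first by have [n' sab] := ma _ _ sb; exists n'; rewrite class_mul.
  move=> p c sc; have [n' sbc] := mb _ _ sc; have [m' sabc] := ma _ _ sbc.
  by exists m'; rewrite class_mul -nmulA.
Qed.

Lemma leavitt_ind a (Q : L -> Prop) :
  Q 0 -> (forall x y, Q x -> Q y -> Q (x + y)) ->
  (forall k v s w t, walk v s -> walk w t -> target v s = target w t ->
     Q (k *: (rpath v s ** gpath w t))) -> Q a.
Proof.
move=> Q0 QD Qm; have [n] := spanned a.
by elim=> // k v s w t b vs wt st _ _ Qb; apply: QD => //; apply: Qm.
Qed.

(** A monomial is fixed by its source and killed by the other vertices, so that
   a finite sum of vertices containing all the sources fixes a given element. *)
Lemma vtx_unitl a : exists2 F : seq (vertex E),
  uniq F & a = (\sum_(v <- F) vtx v) ** a.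
Proof.
suff [F /(_ (undup F) (undup_uniq _))] : exists F : seq (vertex E),
    forall F', uniq F' -> {subset F <= F'} -> (\sum_(v <- F') vtx v) ** a = a.
  move=> aF; exists (undup F); [exact: undup_uniq|rewrite aF // => v].
  by rewrite mem_undup.
elim/leavitt_ind: a => [|x y [F xF] [G yG]|k v s w t vs wt _].
- by exists [::] => F' _ _; rewrite nmul0r.
- exists (F ++ G) => F' uF' sF'; rewrite nmulDr xF ?yG // => v vF; apply: sF';
  by rewrite mem_cat vF ?orbT.
- exists [:: v] => F' uF' sF'; rewrite nmulZr nmulA nmul_suml.
  rewrite (bigD1_seq v) ?sF' ?mem_head //= rpath_src // big1 ?addr0 // => u uv.
  by rewrite vtx_rpath // (negPf uv).
Qed.

Lemma vtx_unitr a : exists2 F : seq (vertex E),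
  uniq F & a = a ** (\sum_(v <- F) vtx v).
Proof.
suff [F /(_ (undup F) (undup_uniq _))] : exists F : seq (vertex E),
    forall F', uniq F' -> {subset F <= F'} -> a ** (\sum_(v <- F') vtx v) = a.
  move=> aF; exists (undup F); [exact: undup_uniq|rewrite aF // => v].
  by rewrite mem_undup.
elim/leavitt_ind: a => [|x y [F xF] [G yG]|k v s w t vs wt _].
- by exists [::] => F' _ _; rewrite nmul0l.
- exists (F ++ G) => F' uF' sF'; rewrite nmulDl xF ?yG // => v vF; apply: sF';
  by rewrite mem_cat vF ?orbT.
- exists [:: w] => F' uF' sF'; rewrite nmulZl -nmulA nmul_sumr.
  rewrite (bigD1_seq w) ?sF' ?mem_head //= gpath_src // big1 ?addr0 // => u uv.
  by rewrite gpath_vtx // eq_sym (negPf uv).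
Qed.

Section IdealsOfLeavitt.
Variable P : set L.
Hypothesis iP : two_sided_ideal P.

Lemma ideal_vtxl a : (forall v, P (vtx v ** a)) -> P a.
Proof.
move=> Pa; have [F _ ->] := vtx_unitl a.
by rewrite nmul_suml; apply: ideal_sum.
Qed.

Lemma ideal_vtxr a : (forall v, P (a ** vtx v)) -> P a.
Proof.
move=> Pa; have [F _ ->] := vtx_unitr a.
by rewrite nmul_sumr; apply: ideal_sum.
Qed.

Lemma idealZ k a : P a -> P (k *: a).
Proof.
move=> Pa; have [F _ ->] := vtx_unitl a.
by rewrite -nmulZl; apply: ideal_mull.
Qed.

Lemma ideal_target v s : walk v s -> P (vtx v) -> P (vtx (target v s)).
Proof.
move=> vs Pv; rewrite -gpath_rpath // -rpath_src //.
by apply: ideal_mull => //; apply: ideal_mulr.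
Qed.

Lemma ideal_rpath v s : P (vtx (target v s)) -> P (rpath v s).
Proof. by rewrite -rpath_tgt; apply: ideal_mull. Qed.

End IdealsOfLeavitt.

Lemma leavitt_prime_idealP P : two_sided_ideal P -> P != setT ->
  prime_ideal P <-> (forall a b, (forall r, P (a ** r ** b)) -> P a \/ P b).
Proof.
apply: prime_idealP => a.
by have [F _ aF] := vtx_unitr a; eexists; apply: aF.
Qed.

(** For a prime [P] this is the maximal tail that classifies [P], up to a prime
   of K[x, x^-1]. *)
Definition tail_of P : set (vertex E) := [set v | ~ P (vtx v)].

Lemma tail_of_connects P v w :
  two_sided_ideal P -> connects v w -> tail_of P w -> tail_of P v.
Proof.
by move=> iP /connectsP[s vs <-] + Pv; apply; apply: ideal_target.
Qed.

(** (MT3) is primeness: if [v] and [w] are not in [P], neither is all of v L w, so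
   some monomial that starts at [v] and ends at [w] lies outside [P], and so does
   the common range of its two paths. *)
Lemma prime_tail P : row_finite E -> prime_ideal P -> maximal_tail (tail_of P).
Proof.
move=> rf prP; have [iP Pprop _] := prP.
split.
- apply: contrapT => /set0P/negP/negPn/eqP P0; move/eqP: Pprop; apply.
  apply/seteqP; split=> // a _; apply: (ideal_vtxl iP) => v; apply: ideal_mulr => //.
  by apply: contrapT => nPv; have : tail_of P v by []; rewrite P0.
- by move=> v w Pw vw; apply: tail_of_connects Pw.
- move=> v Pv [e0 e0v]; apply: contrapT => Pr; apply: Pv.
  have [es ues esv] := row_finite_seq v rf.
  rewrite (vtx_sum ues) //; last first.
    by apply/eqP=> es0; have := esv e0; rewrite es0 e0v eqxx.
  apply: ideal_sum => // e; rewrite esv => /eqP ev _; apply: ideal_mulr => //.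
  rewrite -edg_vtx; apply: ideal_mull => //; apply: contrapT => nPe.
  by apply: Pr; exists e.
- move=> v w Pv Pw; have /(leavitt_prime_idealP iP Pprop) elt := prP.
  have : ~ forall r, P (vtx v ** r ** vtx w) by move=> /elt[].
  apply: contra_notP => noy r.
  elim/leavitt_ind: r => [|x y Px Py|k v' s w' t vs wt st].
  + by rewrite nmul0r nmul0l; apply: ideal0.
  + by rewrite nmulDr nmulDl; apply: idealD.
  + rewrite nmulZr nmulZl; apply: idealZ => //.
    rewrite -!nmulA gpath_vtx // nmulA vtx_rpath //.
    case: eqVneq => [vv|_]; last by rewrite nmul0l; apply: ideal0.
    case: eqVneq => [ww|_]; last by rewrite nmul0r; apply: ideal0.
    subst v' w'; apply: ideal_mulr => //; apply: ideal_rpath => //.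
    apply: contrapT => nPy; apply: noy; exists (target v s); split=> //.
      by apply/connectsP; exists s.
    by apply/connectsP; exists t.
Qed.

End Leavitt.

(** * Ideals under the exit condition *)

Section Reduction.
Variables (K : fieldType) (E : graph).
Hypothesis rf : row_finite E.
Local Notation L := (leavitt K E).
Implicit Types (v w u : vertex E) (e f g : edge E) (s t q d : seq (edge E)).
Implicit Types (a b c x y z : L) (k : K) (P J : set L).
Local Notation vtx := (vtx K).
Local Notation edg := (edg K).
Local Notation gst := (gst K).
Local Notation rpath := (rpath K).
Local Notation gpath := (gpath K).

Lemma gspan_mul_edg n a e : gspan n.+1 a -> gspan n (a ** edg e).
Proof.
have [mD mZ] := mulr_linear (edg e).
apply: (gspan_linear mD mZ) => v s w [|f t] vs wt st tn /=.
  have sw : target v s = w := st; rewrite -nmulA -{1}vtx_edg [vtx w ** _]nmulA.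
  rewrite vtx_mul; case: eqVneq => [we|_]; last first.
    by rewrite nmul0l nmul0r; constructor.
  have ve := etrans sw we; rewrite we vtx_edg.
  have wse : walk v (s ++ [:: e]) by rewrite cats1 walk_rcons vs ve eqxx.
  have -> : rpath v s ** edg e = rpath v (s ++ [:: e]).
    by rewrite rpath_cat //= edg_vtx.
  exact: gspan_rpath.
rewrite -!nmulA gst_edg; case/andP: wt => _ wt.
case: eqVneq => [_|_]; last by rewrite !nmul0r; constructor.
by rewrite gpath_src //; apply: gspan_mono.
Qed.

Lemma gspan_mul_vtx n a w : gspan n a -> gspan n (a ** vtx w).
Proof.
have [mD mZ] := mulr_linear (vtx w).
apply: (gspan_linear mD mZ) => v s w' t vs wt st tn.
rewrite -nmulA gpath_vtx //; case: eqVneq => _; first exact: gspan_mono.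
by rewrite nmul0r; constructor.
Qed.

Lemma gspan_mul_sink n a w :
  (forall e, src e <> w) -> gspan n a -> gspan 0 (a ** vtx w).
Proof.
move=> sink; have [mD mZ] := mulr_linear (vtx w).
apply: (gspan_linear mD mZ) => v s w' t vs wt st tn.
rewrite -nmulA gpath_vtx //; case: eqVneq => [ww|_]; last first.
  by rewrite nmul0r; constructor.
subst w'; case: t wt st {tn} => [|e t] /=; last by case/andP => /eqP /sink.
by move=> _ st; apply: (@gspan_mono K E 0 v s w [::]).
Qed.

(** Right multiplication by an edge shortens ghost paths, and at a sink no
   ghost path starts; summing over the edges leaving a vertex, one of these
   products stays outside the ideal. *)
Lemma absorb_ghosts P a : two_sided_ideal P -> ~ P a ->
  exists z, gspan 0 (a ** z) /\ ~ P (a ** z).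
Proof.
move=> iP; have [n] := spanned a; elim: n a => [|n IH] a sa nPa.
all: have [w nPw] : exists w, ~ P (a ** vtx w)
  by apply: contrapT => /forallNP aP; apply: nPa; apply: (ideal_vtxr iP) => v;
     apply: contrapT; apply: aP.
  by exists (vtx w); split=> //; apply: gspan_mul_vtx.
have [[e0 e0w]|/forallNP sink] := pselect (exists e, src e = w); last first.
  by exists (vtx w); split=> //; apply: gspan_mul_sink sa.
have [es ues esw] := row_finite_seq w rf.
have [e nPe] : exists e, ~ P (a ** edg e).
  apply: contrapT => /forallNP aP; apply: nPw; rewrite (vtx_sum K ues) //.
    rewrite nmul_sumr; apply: ideal_sum => // e _ _; rewrite nmulA.
    by apply: ideal_mulr => //; apply: contrapT; apply: aP.
  by apply/eqP=> es0; have := esw e0; rewrite es0 e0w eqxx.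
have [z [sz nPz]] := IH _ (gspan_mul_edg e sa) nPe.
by exists (edg e ** z); rewrite nmulA.
Qed.

(** The paths in [S] are distinct, so that a shortest one can be isolated. *)
Lemma rpath_sum b u w : gspan 0 b ->
  exists (S : seq (seq (edge E))) (k_ : seq (edge E) -> K),
  [/\ uniq S, forall s, s \in S -> walk u s /\ target u s = w &
      vtx u ** b ** vtx w = \sum_(s <- S) k_ s *: rpath u s].
Proof.
elim=> [|k v s w' t c vs wt st + _ [S [k_ [uS wS cS]]]].
  by exists [::], (fun=> 0); rewrite nmul0r nmul0l big_nil.
rewrite leqn0 size_eq0 => /eqP t0; subst t; have vw : target v s = w' := st.
rewrite nmulDr nmulDl cS nmulZr nmulZl /= -vw rpath_tgt vtx_rpath //.
case: eqVneq => [uv|_]; last first.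
  by exists S, k_; rewrite nmul0l scaler0 add0r.
subst v; rewrite -rpath_tgt -nmulA vtx_mul.
case: eqVneq => [uw|_]; last by exists S, k_; rewrite nmul0r scaler0 add0r.
rewrite rpath_tgt.
pose l s' := (if s' \in S then k_ s' else 0) + (if s' == s then k else 0).
have lS s' : s' \in S -> s' != s -> l s' = k_ s'.
  by rewrite /l => -> /negPf ->; rewrite addr0.
case: (boolP (s \in S)) => sS.
  exists S, l; split=> //; rewrite (bigD1_seq s) //= [RHS](bigD1_seq s) //=.
  rewrite addrA {1}/l sS eqxx scalerDl [k *: _ + _]addrC; congr (_ + _).
  rewrite big_seq_cond [RHS]big_seq_cond; apply: eq_bigr => s' /andP[s'S s's].
  by rewrite -lS.
exists (s :: S), l; split=> [|s'|]; first by rewrite /= sS.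
  by rewrite inE => /orP[/eqP ->|/wS].
rewrite big_cons {1}/l (negPf sS) eqxx add0r; congr (_ + _).
rewrite big_seq [RHS]big_seq; apply: eq_bigr => s' s'S; rewrite -lS //.
by apply: contraNneq sS => <-.
Qed.

(** Repeated paths are allowed and [n] is only an upper bound, so that conjugation
   by a path, which kills some of the terms, preserves the predicate. *)
Inductive closed_sum w : nat -> L -> Prop :=
| closed_sum0 n : closed_sum w n 0
| closed_sumD n k t b : walk w t -> t != [::] -> target w t = w ->
    closed_sum w n b -> closed_sum w n.+1 (k *: rpath w t + b).

Lemma closed_sumW w n b : closed_sum w n b -> closed_sum w n.+1 b.
Proof. by elim=> [m|m k t c wt tn tt _ sc]; constructor. Qed.

Lemma gpath_conj w d t : walk w d -> walk w t -> t != [::] -> target w t = w ->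
  gpath w d ** rpath w t ** rpath w d = 0 \/
  exists q, [/\ walk (target w d) q, q != [::], target (target w d) q = target w d,
    t ++ d = d ++ q & gpath w d ** rpath w t ** rpath w d = rpath (target w d) q].
Proof.
move=> wd wt t0 tt.
have wtd : walk w (t ++ d) by rewrite walk_cat wt tt.
have -> : gpath w d ** rpath w t ** rpath w d = gpath w d ** rpath w (t ++ d).
  by rewrite rpath_cat // tt nmulA.
have [[q dq]|[q dq]|[e [f [q [s' [t' [ef de df]]]]]]] := prefix_cases d (t ++ d).
- right; exists q; rewrite dq.
  have := wtd; rewrite dq walk_cat => /andP[_ ->].
  rewrite -target_cat -dq target_cat tt; split=> //.
    move/(congr1 size): dq; rewrite !size_cat addnC => /eqP.
    by rewrite eqn_add2l -!size_eq0 => /eqP <-; rewrite size_eq0.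
  by rewrite dq gpath_rpath_prefix // -dq.
- move/(congr1 size): dq; rewrite !size_cat => dq.
  by case: t t0 {wt tt wtd} dq => //= e t _; lia.
- by left; rewrite df (gpath_rpath_orth K ef de) // -df.
Qed.

Lemma closed_sum_conj w d n b : walk w d -> closed_sum w n b ->
  closed_sum (target w d) n (gpath w d ** b ** rpath w d).
Proof.
move=> wd; elim=> [m|m k t c wt tn tt _ sc].
  by rewrite nmul0r nmul0l; constructor.
rewrite nmulDr nmulDl nmulZr nmulZl.
have [->|[q [wq qn tq _ ->]]] := gpath_conj wd wt tn tt.
  by rewrite scaler0 add0r; apply: closed_sumW.
by constructor.
Qed.

Lemma rpath_closed_sum w (S : seq (seq (edge E))) (k_ : seq (edge E) -> K)
    (F : seq (edge E) -> L) :
  (forall s, s \in S -> k_ s *: F s = 0 \/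
    exists t, [/\ walk w t, t != [::], target w t = w & F s = rpath w t]) ->
  exists n, closed_sum w n (\sum_(s <- S) k_ s *: F s).
Proof.
elim: S => [|s S IH] SF; first by exists 0%N; rewrite big_nil; constructor.
have [s' s'S|m sm] := IH; first by apply: SF; rewrite inE s'S orbT.
rewrite big_cons; have [->|[t [wt tn tt ->]]] := SF s (mem_head _ _).
  by rewrite add0r; exists m.
by exists m.+1; constructor.
Qed.

(** Multiplication on the left by the ghost of a shortest path turns this path
   into its range, while every other path is killed or loses a proper prefix. *)
Lemma isolate_vertex P b : two_sided_ideal P -> gspan 0 b -> ~ P b ->
  exists x y w n k c, [/\ ~ P (vtx w), k != 0, closed_sum w n c &
    x ** b ** y = k *: vtx w + c].
Proof.
move=> iP sb nPb.
have [u nPu] : exists u, ~ P (vtx u ** b).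
  by apply: contrapT => /forallNP bP; apply: nPb; apply: (ideal_vtxl iP) => v;
     apply: contrapT; apply: bP.
have [w nPw] : exists w, ~ P (vtx u ** b ** vtx w).
  by apply: contrapT => /forallNP bP; apply: nPu; apply: (ideal_vtxr iP) => v;
     apply: contrapT; apply: bP.
have [S [k_ [uS wS bS]]] := rpath_sum u w sb.
have ex : exists n, has (fun s => (k_ s != 0) && (size s == n)) S.
  apply: contrapT => /forallNP no; apply: nPw; rewrite bS.
  apply: ideal_sum => // s sS _.
  have [->|ks] := eqVneq (k_ s) 0; first by rewrite scale0r; apply: ideal0.
  by case: (no (size s)); apply/hasP; exists s; rewrite ?ks ?eqxx.
case: (ex_minnP ex) => m /hasP[s sS /andP[ks /eqP sm]] mmin.
have [us sw] := wS s sS.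
have [s' sS'|n sc] := @rpath_closed_sum w [seq s' <- S | s' != s] k_
  (fun s' => gpath u s ** rpath u s').
  move: sS'; rewrite mem_filter => /andP[s's s'S]; have [us' s'w] := wS s' s'S.
  have [->|ks'] := eqVneq (k_ s') 0; first by left; rewrite scale0r.
  have ss' : (size s <= size s')%N.
    by rewrite sm; apply: mmin; apply/hasP; exists s'; rewrite // ks' eqxx.
  have [[q dq]|[q dq]|[e [f [q [s1 [t1 [ef de df]]]]]]] := prefix_cases s s'.
  - right; exists q; subst s'; move: us'; rewrite walk_cat sw => /andP[_ wq].
    split=> //; first by apply: contraNneq s's => ->; rewrite cats0.
      by rewrite -[X in target X q]sw -target_cat.
    by rewrite gpath_rpath_prefix ?sw // walk_cat us sw.
  - case/eqP: s's; rewrite dq; case: q dq => [|e q] dq; first by rewrite cats0.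
    by move: ss'; rewrite dq size_cat /=; lia.
  - by left; rewrite df (gpath_rpath_orth K ef de) ?scaler0 // -df.
exists (gpath u s ** vtx u), (vtx w), w, n, (k_ s); eexists; split=> //.
- by move=> Pw; apply: nPw; apply: ideal_mull.
- exact: sc.
- rewrite -nmulA -nmulA [vtx u ** _]nmulA bS nmul_sumr (bigD1_seq s) //= big_filter.
  rewrite nmulZr gpath_rpath // sw; congr (_ + _).
  by apply: eq_bigr => s' _; rewrite nmulZr.
Qed.

(** Conjugation turns closed simple paths into closed paths that need not be
   simple, so the condition is used for all closed paths. *)
Definition exit_condition (M : set (vertex E)) := forall w t,
  walk w t -> t != [::] -> target w t = w -> M w ->
  exists s g t' f, [/\ t = s ++ g :: t', f != g, src f = src g & M (rng f)].

(** If [d] follows the closed path [t] and then leaves it through an exit, the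
   paths [d] and [t ++ d] diverge, so conjugation by [d] kills [t].  Repeating
   this removes all the closed paths and leaves a vertex. *)
Lemma ideal_vertex P (M : set (vertex E)) w n k c :
  two_sided_ideal P -> exit_condition M -> M w -> k != 0 ->
  closed_sum w n c -> P (k *: vtx w + c) -> exists2 v, M v & P (vtx v).
Proof.
move=> iP ex; elim: n w c => [|n IH] w c Mw k0 sc.
all: have main : P (k *: vtx w) -> exists2 v, M v & P (vtx v)
  by move=> Pw; exists w => //; rewrite -[vtx w]scale1r -(mulVf k0) -scalerA;
     apply: idealZ.
  by inversion sc; rewrite addr0.
inversion sc as [m n0 c0|m l t b wt tn tt sb mn cE].
  by subst c; rewrite addr0.
subst c => Pc.
have [s [g [t' [f [tE fg fsg Mf]]]]] := ex w t wt tn tt Mw.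
pose d := s ++ [:: f].
have [ws sg wt'] : [/\ walk w s, src g = target w s & walk (rng g) t'].
  by move: wt; rewrite tE walk_cat /= => /and3P[ws /eqP sg wt'].
have wd : walk w d by rewrite /d walk_cat ws /= fsg sg eqxx.
have dM : target w d = rng f by rewrite /d target_cat.
(* The new combination is the conjugate of the old one by [d], without [t]. *)
apply: (IH (target w d) (gpath w d ** b ** rpath w d)) => //.
- by rewrite dM.
- exact: closed_sum_conj.
- have -> : k *: vtx (target w d) + gpath w d ** b ** rpath w d =
      gpath w d ** (k *: vtx w + (l *: rpath w t + b)) ** rpath w d; last first.
    by apply: ideal_mulr => //; apply: ideal_mull.
  rewrite !nmulDr !nmulDl !nmulZr !nmulZl gpath_src // gpath_rpath //.
  have [->|[q [_ _ _ tdq _]]] := gpath_conj wd wt tn tt.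
    by rewrite scaler0 add0r.
  case/eqP: fg; move: tdq; rewrite tE /d -!catA /= => /eqP.
  by rewrite eqseq_cat // eqxx /= eqseq_cons => /andP[/eqP].
Qed.

(** An element of [P] outside [J] would produce a vertex of [M] in [P]. *)
Lemma ideal_sub P J (M : set (vertex E)) :
  two_sided_ideal P -> two_sided_ideal J -> exit_condition M ->
  tail_of J `<=` M -> M `<=` tail_of P -> P `<=` J.
Proof.
move=> iP iJ ex JM MP a Pa; apply: contrapT => nJa.
have [z [sz nJz]] := absorb_ghosts iJ nJa.
have [x [y [w [n [k [c [nJw k0 sc E']]]]]]] := isolate_vertex iJ sz nJz.
have [|v Mv] := ideal_vertex iP ex (JM _ nJw) k0 sc; last exact: MP.
by rewrite -E'; apply: ideal_mulr => //; apply: ideal_mull => //; apply: ideal_mulr.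
Qed.

(** A closed path starts with a closed simple path at the same base, and an exit
   of this part is an exit of the whole. *)
Lemma gamma_exit M : max_tails_gamma E M -> exit_condition M.
Proof.
case=> -[_ MT1 _ _] ex w t; have [m] := ubnP (size t).
elim: m w t => // m IH w [|e p] //= sm /andP[/eqP ew wp] _ tw Mw.
have wep : walk w (e :: p) by rewrite /= ew eqxx.
have [/hasP[f fp /eqP fw]|nf] := boolP (has (fun f => src f == w) p).
  case/splitPr: fp sm wp tw wep => p1 p2 sm wp tw wep.
  move: (wp); rewrite walk_cat /= => /and3P[wp1 /eqP f1 _].
  have we1 : walk w (e :: p1) by rewrite /= ew eqxx.
  have te1 : target w (e :: p1) = w by rewrite -[RHS]fw f1.
  have se1 : (size (e :: p1) < m)%N by move: sm; rewrite size_cat /=; lia.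
  have [s [g [t' [f' [pE fg fsg Mf]]]]] := IH w (e :: p1) se1 we1 isT te1 Mw.
  exists s, g, (t' ++ f :: p2), f'; split=> //.
  by rewrite -cat_cons pE -catA.
have csp : closed_simple_path w e p.
  split=> //; first by rewrite -walk_is_path ew.
    by rewrite -[RHS]tw /target /= last_map.
  by move=> f fp fw; move/hasPn: nf => /(_ f fp); rewrite fw eqxx.
have [|f [[g gp [fg fng]] Mf]] := ex w e p csp.
  split=> [|f fep]; first by case: csp.
  have MT v u : connects v u -> M u -> M v by move=> vu Mu; apply: MT1 vu.
  move: wep tw; case/splitPr: fep => q1 q2.
  rewrite walk_cat target_cat /= => /and3P[wq1 /eqP fq1 wq2] tq2.
  have Mf : M (rng f) by apply: MT Mw; apply/connectsP; exists q2.
  split=> //; apply: MT Mf; apply/connectsP; by exists [:: f]; rewrite /= ?eqxx.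
have [s [t' tE]] : exists s t', e :: p = s ++ g :: t'.
  by case/splitPr: gp => p1 p2; exists p1, p2.
by exists s, g, t', f; split=> //; apply/eqP.
Qed.

End Reduction.

(** * A representation attached to a maximal tail *)

Section Representation.
Variables (K : fieldType) (E : graph) (M : set (vertex E)).
Hypothesis mtM : maximal_tail M.
Local Notation L := (leavitt K E).

Variable outs : vertex E -> seq (edge E).
Hypothesis outs_uniq : forall v, uniq (outs v).
Hypothesis mem_outs : forall v e, (e \in outs v) = (src e == v) && `[< M (rng e) >].

Variables (R : comNzRingType) (io : {rmorphism K -> R}) (lam lam' : edge E -> R).
Hypothesis lamK : forall e, lam e * lam' e = 1.

Local Notation W := (vertex E -> nat -> R).
Implicit Types (v w u : vertex E) (e : edge E) (h : W) (x y : L).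
Implicit Types (a b : lpa_term K E).

(** [TEdge e] pushes the values at [rng e] forward along the injection
   [n |-> n * k + i] of nat into itself, where [k] is the size of [outs (src e)]
   and [i] the position of [e] in it; [TGhost e] pulls the values at [src e] back.
   The weights [lam] are free, as each of them is compensated by [lam']. *)
Fixpoint op a : W -> W :=
  match a with
  | TVertex u => fun h w n => if (w == u) && `[< M u >] then h w n else 0
  | TEdge e => fun h w n =>
      if (e \in outs w) && (n %% size (outs w) == index e (outs w))%N
      then lam e * h (rng e) (n %/ size (outs w))%N else 0
  | TGhost e => fun h w n =>
      if (w == rng e) && `[< M (rng e) >]
      then lam' e * h (src e) (n * size (outs (src e)) + index e (outs (src e)))%N
      else 0
  | TZero => fun h w n => 0
  | TAdd a b => fun h w n => op a h w n + op b h w n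
  | TScale k a => fun h w n => io k * op a h w n
  | TMul a b => fun h => op a (op b h)
  end.

Lemma W_ext (h h' : W) : (forall w n, h w n = h' w n) -> h = h'.
Proof. by move=> hh; apply/funext => w; apply/funext => n. Qed.

Lemma op_linear a (r : R) h h' :
  op a (fun w n => r * h w n + h' w n) = fun w n => r * op a h w n + op a h' w n.
Proof.
elim: a h h' => [u|e|e||a IHa b IHb|k a IH|a IHa b IHb] h h' /=; apply: W_ext => w n.
- by case: ifP; rewrite ?mulr0 ?addr0.
- by case: ifP; rewrite ?mulr0 ?addr0 // mulrDr mulrCA.
- by case: ifP; rewrite ?mulr0 ?addr0 // mulrDr mulrCA.
- by rewrite mulr0 addr0.
- by rewrite IHa IHb mulrDr addrACA.
- by rewrite IH mulrDr mulrCA.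
- by rewrite IHb IHa.
Qed.

Lemma op0 a : op a (fun _ _ => 0) = fun _ _ => 0.
Proof.
have zero : (fun _ _ => -1 * 0 + 0) = (fun _ _ => 0) :> W.
  by apply: W_ext => w n; rewrite mulr0 addr0.
have := op_linear a (-1) (fun _ _ => 0) (fun _ _ => 0); rewrite zero => ->.
by apply: W_ext => w n; rewrite mulN1r addNr.
Qed.

Lemma opD a h h' :
  op a (fun w n => h w n + h' w n) = fun w n => op a h w n + op a h' w n.
Proof.
have := op_linear a 1 h h'.
have mul1 (g g' : W) : (fun w n => 1 * g w n + g' w n) = fun w n => g w n + g' w n.
  by apply: W_ext => w n; rewrite mul1r.
by rewrite !mul1.
Qed.

Lemma opZ a (r : R) h : op a (fun w n => r * h w n) = fun w n => r * op a h w n.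
Proof.
have := op_linear a r h (fun _ _ => 0); rewrite op0.
have add0 (g : W) : (fun w n => r * g w n + 0) = fun w n => r * g w n.
  by apply: W_ext => w n; rewrite addr0.
by rewrite !add0.
Qed.

Lemma outs_index v e : e \in outs v -> (index e (outs v) < size (outs v))%N.
Proof. by rewrite index_mem. Qed.

Lemma tail_src e : M (rng e) -> M (src e).
Proof.
case: mtM => _ + _ _ => MT1 Me; apply: MT1 Me _; apply/connectsP.
by exists [:: e]; rewrite //= eqxx.
Qed.

Lemma op_sum (es : seq (edge E)) h w n :
  op (foldr (fun e a => TAdd (TMul (TEdge e) (TGhost e)) a) TZero es) h w n =
  \sum_(e <- es) op (TMul (TEdge e) (TGhost e)) h w n.
Proof. by elim: es => [|e es /= ->]; rewrite ?big_nil ?big_cons. Qed.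

Lemma op_edge_ghost e h w n :
  op (TMul (TEdge e) (TGhost e)) h w n =
  if (e \in outs w) && (n %% size (outs w) == index e (outs w))%N then h w n else 0.
Proof.
rewrite /=; case: ifP => // /andP[ew /eqP ni].
move: (ew); rewrite mem_outs => /andP[/eqP sw Mr]; rewrite eqxx Mr /= mulrA lamK.
by rewrite mul1r sw -ni -divn_eq.
Qed.

(** The relations hold because [n |-> (n %% k, n %/ k)] is a bijection from
   [nat] to [k] copies of [nat]: the functions on [nat] attached to [v]
   decompose along the edges of [outs v]. *)
Lemma op_eq a b : lpa_eq a b -> op a = op b.
Proof.
elim=> {a b} //=.
- by move=> a b c _ -> _ ->.
- by move=> a a' b b' _ -> _ ->.
- by move=> k a a' _ ->.
- by move=> a a' b b' _ -> _ ->.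
- by move=> a b c; apply/funext => h; apply: W_ext => w n; rewrite addrA.
- by move=> a b; apply/funext => h; apply: W_ext => w n; rewrite addrC.
- by move=> a; apply/funext => h; apply: W_ext => w n; rewrite add0r.
- move=> a; apply/funext => h; apply: W_ext => w n.
  by rewrite rmorphN1 mulN1r addNr.
- by move=> k l a; apply/funext => h; apply: W_ext => w n; rewrite rmorphM mulrA.
- by move=> a; apply/funext => h; apply: W_ext => w n; rewrite rmorph1 mul1r.
- by move=> k a b; apply/funext => h; apply: W_ext => w n; rewrite mulrDr.
- by move=> k l a; apply/funext => h; apply: W_ext => w n; rewrite rmorphD mulrDl.
- by move=> a b c; apply/funext => h; rewrite opD.
- by move=> k a b; apply/funext => h; rewrite opZ.
- by move=> v; apply/funext => h; apply: W_ext => w n; case: (_ && _).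
- move=> v u vu; apply/funext => h; apply: W_ext => w n.
  by case: eqVneq => //= ->; rewrite (negPf vu) /= if_same.
- move=> e; apply/funext => h; apply: W_ext => w n.
  case: (boolP (e \in outs w)) => [|_]; last by rewrite /= if_same.
  by rewrite mem_outs => /andP[/eqP <- /asboolP/tail_src/asboolP ->]; rewrite eqxx.
- move=> e; apply/funext => h; apply: W_ext => w n; rewrite eqxx /=.
  by case: ifP => // /andP[]; rewrite mem_outs => /andP[_ ->].
- by move=> e; apply/funext => h; apply: W_ext => w n; case: (_ && _).
- move=> e; apply/funext => h; apply: W_ext => w n; rewrite eqxx /=.
  by case: ifP => // /andP[_ /asboolP/tail_src/asboolP ->].
- move=> e; apply/funext => h; apply: W_ext => w n; rewrite mem_outs eqxx.
  case: ifP => // /andP[/eqP -> Mr]; rewrite Mr /=.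
  have eo : (index e (outs (src e)) < size (outs (src e)))%N.
    by rewrite outs_index // mem_outs eqxx.
  rewrite modnMDl modn_small // eqxx divnMDl ?(leq_ltn_trans _ eo) //.
  by rewrite divn_small // addn0 mulrA [lam' e * _]mulrC lamK mul1r.
- move=> e f ef; apply/funext => h; apply: W_ext => w n.
  case: ifP => // /andP[_ Mr]; case: ifP => [|_]; last by rewrite mulr0.
  have eo : e \in outs (src e) by rewrite mem_outs eqxx.
  rewrite modnMDl modn_small ?outs_index // => /andP[fo /eqP ef'].
  by case/eqP: ef; rewrite -(nth_index e eo) ef' nth_index.
- move=> v es ues esn esv; apply/funext => h; apply: W_ext => w n.
  rewrite op_sum; under eq_bigr => e _ do rewrite op_edge_ghost.
  have [->|wv] := eqVneq w v; last first.
    rewrite /= big_seq big1 // => e; rewrite esv mem_outs => /eqP ->.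
    by rewrite eq_sym (negPf wv).
  case: (asboolP (M v)) => [Mv|nMv] /=; last first.
    rewrite big1 // => e _; rewrite mem_outs; case: ifP => // /andP[/andP[/eqP ev]].
    by move=> /asboolP /tail_src; rewrite ev.
  have [e1 e1v] : exists e, e \in outs v.
    case: es ues esn esv => // e0 es _ _ /(_ e0); rewrite mem_head => /esym/eqP e0v.
    case: mtM => _ _ MT2 _; have [|e [ev Me]] := MT2 v Mv; first by exists e0.
    by exists e; rewrite mem_outs ev eqxx; apply/asboolP.
  have kn : (n %% size (outs v) < size (outs v))%N.
    by rewrite ltn_pmod // (leq_ltn_trans _ (outs_index e1v)).
  (* The only term of the sum that does not vanish at [n]. *)
  pose e2 := nth e1 (outs v) (n %% size (outs v)).
  have e2v : e2 \in outs v by apply: mem_nth.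
  have e2es : e2 \in es by move: e2v; rewrite mem_outs esv => /andP[].
  rewrite (bigD1_seq e2) //= e2v index_uniq // eqxx /= big1 ?addr0 // => e ee2.
  case: ifP => // /andP[ev /eqP en]; case/eqP: ee2.
  by rewrite /e2 en nth_index.
Qed.

Definition act x : W -> W := op (repr x).

Lemma act_class a : act (lpa_class a) = op a.
Proof. exact/op_eq/lpa_repr_class. Qed.

Lemma act0 : act 0 = fun _ _ _ => 0.
Proof. exact: (act_class TZero). Qed.

Lemma actD x y h : act (x + y) h = fun w n => act x h w n + act y h w n.
Proof.
by elim/lpa_classW: x => a; elim/lpa_classW: y => b; rewrite -class_add !act_class.
Qed.

Lemma actZl k x h : act (k *: x) h = fun w n => io k * act x h w n.
Proof. by elim/lpa_classW: x => a; rewrite -class_scale !act_class. Qed.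

Lemma actM x y h : act (x ** y) h = act x (act y h).
Proof.
by elim/lpa_classW: x => a; elim/lpa_classW: y => b; rewrite -class_mul !act_class.
Qed.

Lemma actN x h : act (- x) h = fun w n => - act x h w n.
Proof.
rewrite -scaleN1r actZl; apply: W_ext => w n.
by rewrite rmorphN1 mulN1r.
Qed.

Lemma act_zero x : act x (fun _ _ => 0) = fun _ _ => 0.
Proof. exact: op0. Qed.

Lemma actZ x (r : R) h : act x (fun w n => r * h w n) = fun w n => r * act x h w n.
Proof. exact: opZ. Qed.

Lemma act_vtx v h :
  act (vtx K v) h = fun w n => if (w == v) && `[< M v >] then h w n else 0.
Proof. by rewrite act_class. Qed.

Lemma act_edg e h : act (edg K e) h = fun w n =>
  if (e \in outs w) && (n %% size (outs w) == index e (outs w))%N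
  then lam e * h (rng e) (n %/ size (outs w))%N else 0.
Proof. by rewrite act_class. Qed.

Definition annihilator : set L := [set x | forall h, act x h = fun _ _ => 0].

Lemma annihilator_ideal : two_sided_ideal annihilator.
Proof.
split=> [h|x y Jx Jy h|z x Jx h|z x Jx h].
- by rewrite act0.
- by rewrite actD actN Jx Jy; apply: W_ext => w n; rewrite subr0.
- by rewrite actM Jx act_zero.
- by rewrite actM Jx.
Qed.

Lemma annihilator_tail : tail_of annihilator = M.
Proof.
apply/seteqP; split=> v /=.
  move=> nJ; apply: contrapT => nMv; apply: nJ => h; rewrite act_vtx.
  by apply: W_ext => w n; case: ifP => // /andP[_ /asboolP].
move=> Mv /(_ (fun _ _ => 1)); rewrite act_vtx => /(congr1 (fun h => h v 0%N)).
by rewrite eqxx /=; case: asboolP => // _ /eqP; rewrite oner_eq0.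
Qed.

End Representation.

Lemma outs_exists (E : graph) (M : set (vertex E)) : row_finite E ->
  exists outs : vertex E -> seq (edge E), (forall v, uniq (outs v)) /\
    forall v e, (e \in outs v) = (src e == v) && `[< M (rng e) >].
Proof.
move=> rf; suff /choice[outs oP] : forall v, exists s : seq (edge E),
    uniq s /\ forall e, (e \in s) = (src e == v) && `[< M (rng e) >].
  by exists outs; split=> v; case: (oP v).
move=> v; have [es ues esv] := row_finite_seq v rf.
exists [seq e <- es | `[< M (rng e) >]]; split; first exact: filter_uniq.
by move=> e; rewrite mem_filter esv andbC.
Qed.

(** Two ideals not contained in the annihilator [P] each contain a vertex of [M].
   As [M] is directed they contain a common one, which lies in their product, so
   [P] is prime.  Uniqueness is [ideal_sub] in both directions. *)
Lemma gamma_prime (E : graph) (K : fieldType) (M : set (vertex E)) :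
  row_finite E -> max_tails_gamma E M ->
  exists P : set (leavitt K E), [/\ prime_ideal P, tail_of P = M &
    forall P', prime_ideal P' -> tail_of P' = M -> P' = P].
Proof.
move=> rf gM; have [mtM _] := gM; have [outs [uo mo]] := outs_exists M rf.
have lamK (e : edge E) : 1 * 1 = 1 :> K by rewrite mul1r.
pose P := @annihilator K E M outs K idfun (fun=> 1) (fun=> 1).
have iP : two_sided_ideal P := annihilator_ideal mtM uo mo idfun lamK.
have tP : tail_of P = M := annihilator_tail mtM uo mo idfun lamK.
have sub (I : set (leavitt K E)) : two_sided_ideal I -> ~ (I `<=` P) ->
    exists2 v, M v & I (vtx K v).
  move=> iI nIP; apply: contrapT => no; apply: nIP.
  apply: (ideal_sub rf iI iP (gamma_exit gM)); first by rewrite tP.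
  by move=> v Mv Iv; apply: no; exists v.
exists P; split=> //.
- split=> //.
    apply/eqP => PT; case: mtM => -[v Mv] _ _ _.
    by move: Mv; rewrite -tP /tail_of /= PT; apply.
  move=> I J iI iJ IJ; apply: contrapT => /not_orP[].
  move=> /sub[//|v Mv Iv] /sub[//|w Mw Jw].
  have [_ _ _ MT3] := mtM; have [y [My vy wy]] := MT3 v w Mv Mw.
  have inI Q u : two_sided_ideal Q -> Q (vtx K u) -> connects u y -> Q (vtx K y).
    by move=> iQ Qu /connectsP[s us <-]; apply: ideal_target.
  have : tail_of P y by rewrite tP.
  by apply; rewrite -vtx_idem; apply: IJ; [apply: (inI I v)|apply: (inI J w)].
- move=> P' prP' tP'; have [iP' _ _] := prP'; apply/seteqP; split.
    by apply: (ideal_sub rf iP' iP (gamma_exit gM)); rewrite ?tP ?tP'.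
  by apply: (ideal_sub rf iP iP' (gamma_exit gM)); rewrite ?tP ?tP'.
Qed.

(** * Laurent polynomials *)

Section LaurentPolynomials.
Variable K : fieldType.
Implicit Types (p q : {poly K}) (r s : laurent K).

Fact laurent_poly_subproof p : tofrac p \in @laurent_pred K.
Proof. by apply/asboolP; exists p, 0%N; rewrite expr0 divr1. Qed.

Definition laurent_poly p : laurent K := Laurent (laurent_poly_subproof p).

Fact laurent_poly_zmod_morphism : zmod_morphism laurent_poly.
Proof. by move=> p q; apply: val_inj; rewrite [RHS]rmorphB /= tofracB. Qed.

Fact laurent_poly_monoid_morphism : monoid_morphism laurent_poly.
Proof.
split=> [|p q]; apply: val_inj; first by rewrite [RHS]rmorph1 /= tofrac1.
by rewrite [RHS]rmorphM /= tofracM.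
Qed.

HB.instance Definition _ := GRing.isZmodMorphism.Build {poly K} (laurent K)
  laurent_poly laurent_poly_zmod_morphism.
HB.instance Definition _ := GRing.isMonoidMorphism.Build {poly K} (laurent K)
  laurent_poly laurent_poly_monoid_morphism.

Lemma laurent_poly_inj : injective laurent_poly.
Proof. by move=> p q /(congr1 val)/= /eqP; rewrite tofrac_eq => /eqP. Qed.

Fact laurent_Xinv_subproof : 1 / tofrac ('X : {poly K}) \in @laurent_pred K.
Proof. by apply/asboolP; exists 1, 1%N; rewrite tofrac1 expr1. Qed.

Definition laurent_Xinv : laurent K := Laurent laurent_Xinv_subproof.

Lemma laurent_XK : laurent_poly 'X * laurent_Xinv = 1.
Proof.
apply: val_inj; rewrite [LHS]rmorphM [RHS]rmorph1 /= mul1r divff //.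
by rewrite tofrac_eq0 polyX_eq0.
Qed.

Lemma laurentP r : exists p n, r = laurent_poly p * laurent_Xinv ^+ n.
Proof.
case: r => f fL; have /asboolP[p [n fE]] := fL; exists p, n; apply: val_inj.
by rewrite [RHS]rmorphM rmorphXn /= mul1r fE exprVn.
Qed.

Lemma laurent_mulf_eq0 r s : r * s = 0 -> r = 0 \/ s = 0.
Proof.
move=> /(congr1 val); rewrite rmorphM rmorph0 => /eqP; rewrite mulf_eq0.
by case/orP=> /eqP v0; [left|right]; apply: val_inj; rewrite v0 rmorph0.
Qed.

Lemma laurent_prime_idealP (Q : set (laurent K)) :
  two_sided_ideal Q -> Q != setT ->
  prime_ideal Q <-> (forall r s, Q (r * s) -> Q r \/ Q s).
Proof.
move=> iQ Qprop.
rewrite prime_idealP //; last by move=> r; exists 1; exact/esym/mulr1.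
split=> Qp r s rs; apply: Qp.
  by move=> t; rewrite -[_ ** s]mulrA [t * s]mulrC mulrA; apply: ideal_mulr.
by have := rs 1; rewrite [r ** 1]mulr1.
Qed.

Lemma laurent_prime0 : prime_ideal [set 0 : laurent K].
Proof.
have i0 : two_sided_ideal [set 0 : laurent K].
  by split=> [|r s -> ->|s r ->|s r ->] /=; rewrite ?subr0 ?nmul0r ?nmul0l.
apply/laurent_prime_idealP => // [|r s]; last exact: laurent_mulf_eq0.
apply/eqP => e; have : [set 0 : laurent K] 1 by rewrite e.
by move=> /eqP; rewrite oner_eq0.
Qed.

Lemma laurent_prime1 (Q : set (laurent K)) : prime_ideal Q -> ~ Q 1.
Proof.
case=> iQ /eqP Qprop _ Q1; apply: Qprop; apply/seteqP; split=> // r _.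
by rewrite -[r]mulr1; apply: ideal_mull.
Qed.

End LaurentPolynomials.

(** * The corner at a cycle without exits *)

Section Cycle.
Variables (K : fieldType) (E : graph) (M : set (vertex E)).
Variables (v : vertex E) (c : seq (edge E)).
Hypothesis rf : row_finite E.
Hypothesis mtM : maximal_tail M.
Hypothesis c_neq0 : c != [::].
Hypothesis walk_c : walk v c.
Hypothesis target_c : target v c = v.
Hypothesis simple_c : forall f, f \in behead c -> src f <> v.
Hypothesis noexit_c : forall g f, g \in c -> src f = src g -> M (rng f) -> f = g.
Hypothesis Mv : M v.
Local Notation L := (leavitt K E).
Local Notation vtx := (vtx K).
Local Notation edg := (edg K).
Local Notation gst := (gst K).
Local Notation rpath := (rpath K).
Local Notation gpath := (gpath K).
Implicit Types (u w : vertex E) (e f g : edge E) (s t q : seq (edge E)).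
Implicit Types (P : set L) (a b : L) (p : {poly K}).

Lemma tail_connects u w : connects u w -> M w -> M u.
Proof. by case: mtM => _ MT1 _ _ uw Mw; apply: MT1 uw. Qed.

Lemma tail_walk u s : walk u s -> M (target u s) -> M u.
Proof. by move=> us; apply: tail_connects; apply/connectsP; exists s. Qed.

Definition cpow n := flatten (nseq n c).

Lemma cpowD m n : cpow (m + n) = cpow m ++ cpow n.
Proof. by rewrite /cpow nseqD flatten_cat. Qed.

Lemma cpow1 : cpow 1 = c.
Proof. by rewrite /cpow /= cats0. Qed.

Lemma target_cpow n : target v (cpow n) = v.
Proof.
by elim: n => // n IH; rewrite -addn1 cpowD cpow1 target_cat IH target_c.
Qed.

Lemma walk_cpow n : walk v (cpow n).
Proof. by elim: n => // n IH; rewrite /cpow /= walk_cat walk_c target_c. Qed.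

Lemma subset_cpow n : {subset cpow n <= c}.
Proof. by move=> e /flattenP[s /nseqP[-> _]]. Qed.

Lemma target_take j : (j < size c)%N ->
  exists2 g, g \in c & [/\ take j.+1 c = rcons (take j c) g,
    src g = target v (take j c) & (j = 0%N \/ g \in behead c)].
Proof.
move=> jc; have [e0 _] : exists e : edge E, True.
  by case: (c) c_neq0 => // e; exists e.
pose g := nth e0 c j; have gc : g \in c by rewrite mem_nth.
exists g => //; have tg : take j.+1 c = rcons (take j c) g by rewrite -take_nth.
split=> //; last first.
  rewrite /g; case: (c) j jc {g gc tg} => // e p [|j] /= jp; first by left.
  by right; rewrite mem_nth.
by have := walk_c; rewrite -{1}(cat_take_drop j.+1 c) tg walk_cat walk_rcons;
  case/andP=> /andP[_ /eqP].
Qed.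

(** No path in [M] leaves the cycle, so one that starts on it goes round it. *)
Lemma walk_from s : walk v s -> M (target v s) ->
  exists k j, (j < size c)%N /\ s = cpow k ++ take j c.
Proof.
elim/last_ind: s => [|s e IH].
  by exists 0%N, 0%N; rewrite take0 lt0n size_eq0.
rewrite walk_rcons target_rcons => /andP[vs /eqP se] Me.
have Ms : M (target v s).
  by apply: (@tail_walk _ [:: e]); rewrite //= se eqxx.
have [k [j [jc sE]]] := IH vs Ms.
have [g gc [tg sg _]] := target_take jc.
have eg : e = g.
  by apply: noexit_c => //; rewrite se sg sE target_cat target_cpow.
have seE : rcons s e = cpow k ++ take j.+1 c by rewrite sE rcons_cat tg eg.
rewrite seE; have [jc1|jc1] := ltnP j.+1 (size c); first by exists k, j.+1.
exists k.+1, 0%N; rewrite lt0n size_eq0 c_neq0 take0 cats0 take_oversize //.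
by rewrite -addn1 cpowD cpow1.
Qed.

Lemma closed_walk_cpow s : walk v s -> target v s = v -> exists n, s = cpow n.
Proof.
move=> vs tv; have [|k [j [jc sE]]] := walk_from vs; first by rewrite tv.
have [g gc [_ sg [j0|gb]]] := target_take jc.
  by exists k; rewrite sE j0 take0 cats0.
by case: (simple_c gb); rewrite sg -[RHS]tv sE target_cat target_cpow.
Qed.

Lemma walk_back s : walk v s -> M (target v s) ->
  exists q, [/\ {subset q <= c}, walk (target v s) q & target (target v s) q = v].
Proof.
move=> vs Ms; have [k [j [jc sE]]] := walk_from vs Ms.
exists (drop j c); rewrite sE target_cat target_cpow.
have := walk_c; rewrite -{1}(cat_take_drop j c) walk_cat => /andP[_ ->].
by rewrite -target_cat cat_take_drop; split=> // e; apply: mem_drop.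
Qed.

Lemma connects_base u : M u -> connects u v.
Proof.
move=> Mu; case: mtM => _ _ _ MT3.
have [y [My uy /connectsP[s vs sy]]] := MT3 u v Mu Mv.
have [|q [_ yq qv]] := walk_back vs; first by rewrite sy.
apply: connects_trans uy _; apply/connectsP.
by rewrite -sy; exists q.
Qed.

(** Modulo the vertices outside [M], an edge [e] of the cycle is the only one
   leaving its source, so that [e e^*] is the source of [e]. *)
Lemma cycle_unit P y q : two_sided_ideal P -> tail_of P `<=` M ->
  walk y q -> {subset q <= c} -> P (rpath y q ** gpath y q - vtx y).
Proof.
move=> iP PM; elim: q y => [|e q IH] y /=.
  by move=> _ _; rewrite vtx_idem subrr; apply: ideal0.
move=> /andP[/eqP <- eq] qc; have ec : e \in c by apply: qc; rewrite mem_head.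
have Pq : P (rpath (rng e) q ** gpath (rng e) q - vtx (rng e)).
  by apply: IH => // f fq; apply: qc; rewrite inE fq orbT.
apply: (ideal_trans iP (b := edg e ** gst e)).
  have := ideal_mull iP (edg e) (ideal_mulr iP (gst e) Pq).
  by rewrite !nmulBl nmulBr vtx_gst !nmulA.
have [es ues esv] := row_finite_seq (src e) rf.
have ees : e \in es by rewrite esv eqxx.
rewrite (vtx_sum K ues esv) //; last by apply: contraTneq ees => ->.
rewrite (bigD1_seq e) //= opprD addrA subrr add0r.
apply: idealN => //; apply: ideal_sum => // f; rewrite esv => /eqP fe fne.
apply: ideal_mulr => //; rewrite -edg_vtx; apply: ideal_mull => //.
apply: contrapT => nPf; case/eqP: fne; apply: noexit_c => //; exact: PM.
Qed.

Lemma gpath_cpow n N : (n <= N)%N ->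
  gpath v (cpow n) ** rpath v (cpow N) = rpath v (cpow (N - n)).
Proof.
move=> nN; rewrite -{1}(subnKC nN) cpowD gpath_rpath_prefix ?target_cpow //.
by rewrite -cpowD walk_cpow.
Qed.

Lemma rpath_cpowD m n :
  rpath v (cpow (m + n)) = rpath v (cpow m) ** rpath v (cpow n).
Proof. by rewrite cpowD rpath_cat ?target_cpow // -cpowD walk_cpow. Qed.

Definition cpoly p : L := \sum_(i < size p) p`_i *: rpath v (cpow i).

Lemma cpoly_wide p n : (size p <= n)%N ->
  cpoly p = \sum_(i < n) p`_i *: rpath v (cpow i).
Proof.
move=> pn; rewrite /cpoly (big_ord_widen n (fun i => p`_i *: rpath v (cpow i))) //.
rewrite big_mkcond; apply: eq_bigr => i _; case: ltnP => // /(nth_default 0) ->.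
by rewrite scale0r.
Qed.

Lemma cpolyD p p' : cpoly (p + p') = cpoly p + cpoly p'.
Proof.
rewrite (cpoly_wide (size_polyD p p')) (cpoly_wide (leq_maxl _ (size p'))).
rewrite (@cpoly_wide p' (maxn (size p) (size p'))) ?leq_maxr // -big_split /=.
by apply: eq_bigr => i _; rewrite coefD scalerDl.
Qed.

Lemma cpoly0 : cpoly 0 = 0.
Proof. by rewrite /cpoly size_poly0 big_ord0. Qed.

Lemma cpolyZX (k : K) n : cpoly (k *: 'X^n) = k *: rpath v (cpow n).
Proof.
rewrite (@cpoly_wide _ n.+1); last first.
  by apply: leq_trans (size_scale_leq _ _) _; rewrite size_polyXn.
rewrite big_ord_recr /= coefZ coefXn eqxx mulr1 big1 ?add0r // => i _.
by rewrite coefZ coefXn ltn_eqF // mulr0 scale0r.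
Qed.

(** Modulo the vertices outside [M] the corner at [v] consists of the Laurent
   polynomials in the cycle: after multiplication by a high power of the cycle,
   every element of it becomes a polynomial.  All large exponents are allowed, so
   that two elements can share one.  The polynomial is independent of [P], which
   is needed in order to compare [P] with the annihilator of a representation. *)
Lemma corner_poly a : exists N, forall n, (N <= n)%N -> exists p, forall P,
  two_sided_ideal P -> tail_of P `<=` M ->
  P (vtx v ** a ** vtx v ** rpath v (cpow n) - cpoly p).
Proof.
elim/leavitt_ind: a => [|a b [N aN] [N' bN']|k u s w t us wt st].
- exists 0%N => n _; exists 0 => P iP _; rewrite cpoly0 nmul0r !nmul0l subr0.
  exact: ideal0.
- exists (maxn N N') => n; rewrite geq_max => /andP[/aN[p pP] /bN'[p' pP']].
  exists (p + p') => P iP PM; rewrite nmulDr !nmulDl cpolyD opprD addrACA.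
  by apply: idealD => //; [apply: pP|apply: pP'].
rewrite nmulZr nmulZl nmulA vtx_rpath // -nmulA gpath_vtx //.
have trivial_case (x : L) : x = 0 -> exists N, forall n, (N <= n)%N ->
    exists p, forall P, two_sided_ideal P -> tail_of P `<=` M ->
    P (k *: x ** rpath v (cpow n) - cpoly p).
  move=> ->; exists 0%N => n _; exists 0 => P iP _.
  by rewrite scaler0 nmul0l cpoly0 subr0; apply: ideal0.
have [uv|_] := eqVneq v u; last by apply: trivial_case; rewrite nmul0l.
have [wv|_] := eqVneq w v; last by apply: trivial_case; rewrite nmul0r.
subst u w; case: (pselect (M (target v s))) => [Ms|nMs]; last first.
  exists 0%N => n _; exists 0 => P iP PM; rewrite cpoly0 subr0.
  apply: ideal_mulr => //; apply: idealZ => //; apply: ideal_mulr => //.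
  by apply: ideal_rpath => //; apply: contrapT => nP; apply/nMs/PM.
have [q [qc wq tq]] := walk_back us Ms.
have [i sq] : exists i, s ++ q = cpow i.
  by apply: closed_walk_cpow; rewrite ?walk_cat ?us ?target_cat.
have [l tq'] : exists l, t ++ q = cpow l.
  by apply: closed_walk_cpow; rewrite ?walk_cat ?wt ?target_cat -?st.
(* The monomial is the cycle to the power [i] times its ghost to the power [l]. *)
exists l => n ln; exists (k *: 'X^(i + (n - l))) => P iP PM.
rewrite cpolyZX nmulZl -scalerBr; apply: idealZ => //.
have Pq := cycle_unit iP PM wq qc.
have -> : rpath v (cpow (i + (n - l))) = rpath v s **
    (rpath (target v s) q ** gpath (target v s) q) ** gpath v t ** rpath v (cpow n).
  rewrite rpath_cpowD -(gpath_cpow ln) -{1}sq -tq' rpath_cat ?sq ?walk_cpow //.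
  by rewrite gpath_cat ?tq' ?walk_cpow // -st !nmulA.
have -> : rpath v s ** gpath v t =
    rpath v s ** vtx (target v s) ** gpath v t by rewrite rpath_tgt.
rewrite -!nmulBl -nmulBr -opprB nmulNr !nmulNl; apply: idealN => //.
by apply: ideal_mulr => //; apply: ideal_mulr => //; apply: ideal_mull.
Qed.

(** * Evaluation of the corner in the Laurent polynomials *)

Section Evaluation.
Variable outs : vertex E -> seq (edge E).
Hypothesis outs_uniq : forall v, uniq (outs v).
Hypothesis mem_outs : forall v e, (e \in outs v) = (src e == v) && `[< M (rng e) >].

Local Notation R := (laurent K).
Local Notation io := (@laurent_poly K \o polyC).

(** The edge of the cycle that leaves [v] acts with weight [x] and all the
   other edges of the cycle with weight [1], so that the cycle acts as [x]. *)
Definition weight e : R := if src e == v then laurent_poly 'X else 1.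
Definition weight_inv e : R := if src e == v then laurent_Xinv K else 1.

Lemma weightK e : weight e * weight_inv e = 1.
Proof.
by rewrite /weight /weight_inv; case: ifP; rewrite ?mulr1 // laurent_XK.
Qed.

Local Notation W := (vertex E -> nat -> R).
Local Notation act := (@act K E M outs R io weight weight_inv).
Let actM := actM mtM outs_uniq mem_outs io weightK.
Let actD := actD mtM outs_uniq mem_outs io weightK.
Let act_vtx := act_vtx mtM outs_uniq mem_outs io weightK.
Let act_edg := act_edg mtM outs_uniq mem_outs io weightK.
Let actZl := actZl mtM outs_uniq mem_outs io weightK.
Let actN := actN mtM outs_uniq mem_outs io weightK.
Let act0 := act0 mtM outs_uniq mem_outs io weightK.
Let J := annihilator M outs io weight weight_inv.
Let iJ : two_sided_ideal J := annihilator_ideal mtM outs_uniq mem_outs io weightK.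
Let JM : tail_of J = M := annihilator_tail mtM outs_uniq mem_outs io weightK.

Definition unit_vec u : W := fun w n => if (w == u) && (n == 0)%N then 1 else 0.
Definition line (r : R) u : W := fun w n => r * unit_vec u w n.

Lemma act_line a r u h : act a (unit_vec u) = h ->
  act a (line r u) = fun w n => r * h w n.
Proof. by move=> <-; apply: actZ. Qed.

Lemma act_vtx_unit u : M u -> act (vtx u) (unit_vec u) = unit_vec u.
Proof.
move=> Mu; rewrite act_vtx; apply: W_ext => w n; rewrite /unit_vec.
by case: eqVneq => //=; case: asboolP.
Qed.

Lemma act_edg_unit e : e \in c -> M (rng e) ->
  act (edg e) (unit_vec (rng e)) = line (weight e) (src e).
Proof.
move=> ec Me; rewrite act_edg; apply: W_ext => w n; rewrite /line /unit_vec.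
have [->|we] := eqVneq w (src e); last first.
  by rewrite mem_outs eq_sym (negPf we) /= mulr0.
have oe : outs (src e) = [:: e].
  have: forall f, f \in outs (src e) -> f = e.
    by move=> f; rewrite mem_outs => /andP[/eqP fe /asboolP Mf]; apply: noexit_c.
  have : e \in outs (src e) by rewrite mem_outs eqxx; apply/asboolP.
  case: (outs (src e)) (outs_uniq (src e)) => [|f [|g s]] //= + _ oe.
    by rewrite (oe f) ?mem_head.
  by rewrite (oe f) ?mem_head // (oe g) ?inE ?eqxx ?orbT.
by rewrite oe mem_head modn1 divn1 /= !eqxx.
Qed.

Lemma act_rpath_unit u s : walk u s -> {subset s <= c} -> M (target u s) ->
  act (rpath u s) (unit_vec (target u s)) = line (\prod_(e <- s) weight e) u.
Proof.
elim: s u => [|e s IH] u /=.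
  move=> _ _ Mu; rewrite act_vtx_unit // big_nil.
  by apply: W_ext => w n; rewrite /line mul1r.
move=> /andP[/eqP <- es] sc Ms; have Me : M (rng e) by apply: tail_walk es Ms.
rewrite actM IH //; last by move=> f fs; apply: sc; rewrite inE fs orbT.
rewrite (act_line _ (act_edg_unit (sc _ (mem_head _ _)) Me)) big_cons.
by apply: W_ext => w n; rewrite /line mulrA [_ * weight e]mulrC.
Qed.

Lemma weight_cpow n : \prod_(e <- cpow n) weight e = laurent_poly 'X ^+ n.
Proof.
elim: n => [|n IH]; first by rewrite big_nil.
rewrite -addn1 addnC cpowD cpow1 big_cat /= IH exprS; congr (_ * _).
case: c c_neq0 walk_c simple_c => //= e p _ /andP[/eqP ev _] sp.
rewrite big_cons /weight ev eqxx big_seq big1 ?mulr1 // => f /sp.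
by move/eqP/negPf->.
Qed.

Lemma act_cpow n :
  act (rpath v (cpow n)) (unit_vec v) = line (laurent_poly 'X ^+ n) v.
Proof.
have := @act_rpath_unit v (cpow n) (walk_cpow n) (@subset_cpow n).
by rewrite target_cpow weight_cpow; apply.
Qed.

Lemma act_cpoly p : act (cpoly p) (unit_vec v) = line (laurent_poly p) v.
Proof.
rewrite -[in RHS](coefK p) poly_def rmorph_sum /= /cpoly.
elim/big_ind2: _ => [|a r b s ar bs|i _].
- by rewrite act0; apply: W_ext => w n; rewrite /line mul0r.
- by rewrite actD ar bs; apply: W_ext => w n; rewrite /line mulrDl.
- rewrite actZl act_cpow; apply: W_ext => w n; rewrite /line mulrA /=.
  by rewrite -mul_polyC rmorphM rmorphXn.
Qed.

Lemma act_congr a b : J (a - b) -> act a = act b.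
Proof.
move=> Jab; apply/funext => h; apply: W_ext => w n.
have := Jab h; rewrite actD actN => /(congr1 (fun h => h w n)) /eqP.
by rewrite subr_eq0 => /eqP.
Qed.

Definition corner a : L := vtx v ** a ** vtx v.

Definition eval a : R := act (corner a) (unit_vec v) v 0%N.

Lemma line_base r : line r v v 0%N = r.
Proof. by rewrite /line /unit_vec !eqxx mulr1. Qed.

Lemma act_cancel_cpow a n r : act (a ** rpath v (cpow n)) (unit_vec v) = line r v ->
  act a (unit_vec v) = line (r * laurent_Xinv K ^+ n) v.
Proof.
rewrite actM act_cpow (act_line _ erefl) => ar; apply: W_ext => w m.
have /(congr1 (fun h : W => laurent_Xinv K ^+ n * h w m)) := ar.
rewrite mulrA -exprMn [_ * laurent_poly _]mulrC laurent_XK expr1n mul1r => ->.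
by rewrite /line mulrCA mulrA.
Qed.

Lemma corner_eval a : exists N, forall n, (N <= n)%N -> exists p,
  [/\ eval a * laurent_poly 'X ^+ n = laurent_poly p,
      act (corner a) (unit_vec v) = line (eval a) v &
      forall P, two_sided_ideal P -> tail_of P `<=` M ->
        P (corner a ** rpath v (cpow n) - cpoly p)].
Proof.
have [N aN] := corner_poly a; exists N => n /aN[p pP]; exists p.
have := pP J iJ; rewrite JM => /(_ (@subset_refl _ _)) /act_congr Jp.
have act1 : act (corner a) (unit_vec v) =
    line (laurent_poly p * laurent_Xinv K ^+ n) v.
  by apply: act_cancel_cpow; rewrite Jp act_cpoly.
have ea : eval a = laurent_poly p * laurent_Xinv K ^+ n.
  by rewrite /eval act1 line_base.
split=> //; last by rewrite ea.
by rewrite ea -mulrA -exprMn [_ * laurent_poly _]mulrC laurent_XK expr1n mulr1.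
Qed.

Lemma act_corner a : act (corner a) (unit_vec v) = line (eval a) v.
Proof. by have [N /(_ N (leqnn N))[p []]] := corner_eval a. Qed.

Lemma evalB a b : eval (a - b) = eval a - eval b.
Proof. by rewrite /eval /corner nmulBr nmulBl actD actN. Qed.

Lemma cornerM a b : corner (a ** vtx v ** b) = corner a ** corner b.
Proof. by rewrite /corner !nmulA -[_ ** vtx v ** vtx v]nmulA vtx_idem. Qed.

Lemma evalM a b : eval (a ** vtx v ** b) = eval a * eval b.
Proof.
rewrite /eval cornerM actM !act_corner !line_base (act_line _ (act_corner a)).
by rewrite line_base mulrC.
Qed.

Lemma corner_id a : corner (corner a) = corner a.
Proof. by rewrite /corner !nmulA vtx_idem -nmulA vtx_idem. Qed.

Lemma eval_corner a : eval (corner a) = eval a.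
Proof. by rewrite /eval corner_id. Qed.

Lemma corner_vtx : corner (vtx v) = vtx v.
Proof. by rewrite /corner !vtx_idem. Qed.

Lemma eval1 : eval (vtx v) = 1.
Proof.
by rewrite /eval corner_vtx act_vtx_unit // /unit_vec !eqxx.
Qed.

Lemma eval_surj r : exists a, eval a = r.
Proof.
have [p [n ->]] := laurentP r.
have actg : act (gpath v (cpow n)) (unit_vec v) = line (1 * laurent_Xinv K ^+ n) v.
  apply: act_cancel_cpow; rewrite gpath_rpath ?walk_cpow // target_cpow.
  by rewrite act_vtx_unit //; apply: W_ext => w m; rewrite /line mul1r.
exists (cpoly p ** gpath v (cpow n)); rewrite /eval /corner !actM act_vtx_unit //.
rewrite actg mul1r (act_line _ (act_cpoly p)).
have -> : (fun w m => laurent_Xinv K ^+ n * line (laurent_poly p) v w m) =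
    line (laurent_poly p * laurent_Xinv K ^+ n) v.
  by apply: W_ext => w m; rewrite /line mulrA [_ * laurent_poly _]mulrC.
by rewrite (act_line _ (act_vtx_unit Mv)); apply: line_base.
Qed.

Lemma eval_out a b u : ~ M u -> eval (a ** vtx u ** b) = 0.
Proof.
move=> nMu; have Ju : J (vtx u) by apply: contrapT => nJ; apply: nMu; rewrite -JM.
suff Jab : J (corner (a ** vtx u ** b)) by rewrite /eval Jab.
by apply: (ideal_mulr iJ); apply: (ideal_mull iJ); apply: (ideal_mulr iJ);
  apply: (ideal_mull iJ).
Qed.

(** * Lifting and restricting primes *)

(** A prime not containing [v] consists of the elements [a] such that
   v x a y v lies in it for all [x] and [y], so [lift] inverts the passage to the
   corner. *)
Definition lift (Q : set R) : set L := [set a | forall x y, Q (eval (x ** a ** y))].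

Lemma lift_ideal Q : two_sided_ideal Q -> two_sided_ideal (lift Q).
Proof.
move=> iQ; split=> [x y|a b Qa Qb x y|r a Qa x y|r a Qa x y] /=.
- rewrite nmul0r nmul0l -(subrr (vtx v)) evalB subrr; exact: ideal0.
- by rewrite nmulBr nmulBl evalB; apply: idealB.
- by rewrite nmulA; apply: Qa.
- by rewrite nmulA -nmulA; apply: Qa.
Qed.

Lemma lift_corner Q a : two_sided_ideal Q -> lift Q (corner a) <-> Q (eval a).
Proof.
move=> iQ; split=> [/(_ (vtx v) (vtx v))|Qa x y].
  by rewrite -/(corner _) corner_id eval_corner.
rewrite (_ : x ** corner a ** y = x ** vtx v ** (a ** vtx v ** y)).
  by rewrite !evalM; apply: ideal_mull => //; apply: ideal_mulr.
by rewrite /corner !nmulA.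
Qed.

Lemma lift_tail Q : prime_ideal Q -> tail_of (lift Q) = M.
Proof.
move=> prQ; have [iQ _ _] := prQ; apply/seteqP; split=> u /=.
  move=> nQ; apply: contrapT => nMu; apply: nQ => x y.
  by rewrite eval_out //; apply: ideal0.
move=> /connects_base/connectsP[s us sv] /(_ (gpath u s) (rpath u s)).
rewrite -nmulA rpath_src // gpath_rpath // sv eval1.
exact: laurent_prime1.
Qed.

Lemma lift_prime Q : prime_ideal Q -> prime_ideal (lift Q).
Proof.
move=> prQ; have [iQ Qprop _] := prQ; have iF := lift_ideal iQ.
have Fprop : lift Q != setT.
  apply/eqP => FT; have : tail_of (lift Q) v by rewrite lift_tail.
  by apply; rewrite FT.
apply/leavitt_prime_idealP => // a b ab; apply: contrapT => /not_orP[].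
move=> /existsNP[x /existsNP[y nQa]] /existsNP[x' /existsNP[y' nQb]].
have /(laurent_prime_idealP iQ Qprop) elt := prQ.
have [] // := elt (eval (x ** a ** y)) (eval (x' ** b ** y')).
rewrite -evalM; have := ab (y ** vtx v ** x') x y'.
by rewrite !nmulA.
Qed.

Lemma lift_inj Q Q' : prime_ideal Q -> prime_ideal Q' -> lift Q = lift Q' -> Q = Q'.
Proof.
move=> [iQ _ _] [iQ' _ _] QQ'; apply/seteqP; split=> r; have [a <-] := eval_surj r.
  by rewrite -!lift_corner // QQ'.
by rewrite -!lift_corner // QQ'.
Qed.

(** The kernel of [eval] on the corner lies in every ideal that contains the
   vertices outside [M], so an ideal is determined on the corner by its image. *)
Lemma eval_kernel P a :
  two_sided_ideal P -> tail_of P `<=` M -> eval a = 0 -> P (corner a).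
Proof.
move=> iP PM a0; have [N /(_ N (leqnn N))[p [pE _ pP]]] := corner_eval a.
have p0 : p = 0.
  by apply: (@laurent_poly_inj K); rewrite rmorph0 -pE a0 mul0r.
have := pP P iP PM; rewrite p0 cpoly0 subr0 => Pa.
have PN := cycle_unit iP PM (walk_cpow N) (@subset_cpow N).
have := ideal_mull iP (corner a) PN; rewrite nmulBr.
have -> : corner a ** vtx v = corner a by rewrite /corner -nmulA vtx_idem.
move=> /(ideal_congl iP); apply.
by rewrite nmulA; apply: ideal_mulr.
Qed.

Lemma lift_onto P : prime_ideal P -> tail_of P = M ->
  exists2 Q, prime_ideal Q & lift Q = P.
Proof.
move=> prP tP; have [iP Pprop _] := prP.
have PM : tail_of P `<=` M by rewrite tP.
have nPv : ~ P (vtx v) by have : M v by []; rewrite -tP.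
have /(leavitt_prime_idealP iP Pprop) elt := prP.
pose Q : set R := [set r | exists2 a, P (corner a) & eval a = r].
have Qeval a : Q (eval a) <-> P (corner a).
  split=> [[b Pb ba]|Pa]; last by exists a.
  have : P (corner (a - b)) by apply: eval_kernel => //; rewrite evalB ba subrr.
  by rewrite /corner nmulBr nmulBl => /(idealBD iP); apply.
have iQ : two_sided_ideal Q.
  split=> [|_ _ [a Pa <-] [b Pb <-]|r _ [a Pa <-]|r _ [a Pa <-]].
  - exists 0; first by rewrite /corner nmul0r nmul0l; apply: ideal0.
    by rewrite -(subrr (vtx v)) evalB subrr.
  - exists (a - b); last by rewrite evalB.
    by rewrite /corner nmulBr nmulBl; apply: idealB.
  - have [b <-] := eval_surj r; exists (b ** vtx v ** a); last by rewrite evalM.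
    by rewrite cornerM; apply: ideal_mull.
  - have [b <-] := eval_surj r; exists (a ** vtx v ** b); last by rewrite evalM.
    by rewrite cornerM; apply: ideal_mulr.
have Qprop : Q != setT.
  apply/eqP => QT; apply: nPv; rewrite -corner_vtx; apply/Qeval.
  by rewrite QT.
exists Q.
  apply/(laurent_prime_idealP iQ Qprop) => r s; have [a <-] := eval_surj r.
  have [b <-] := eval_surj s => Qab; rewrite !Qeval; apply: elt => t.
  have -> : corner a ** t ** corner b =
      corner ((a ** vtx v ** t) ** vtx v ** b) by rewrite /corner !nmulA.
  by apply/Qeval; rewrite !evalM mulrAC; apply: ideal_mulr.
apply/seteqP; split=> a.
  move=> Qa; have Pc x y : P (corner (x ** a ** y)) by apply/Qeval/Qa.
  have Py y : P (a ** y ** vtx v).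
    case: (elt (vtx v) (a ** y ** vtx v)) => // x.
    by have := Pc x y; rewrite /corner !nmulA.
  by case: (elt a (vtx v)).
move=> Pa x y; apply/Qeval; apply: ideal_mulr => //; apply: ideal_mull => //.
by apply: ideal_mulr => //; apply: ideal_mull.
Qed.

End Evaluation.

End Cycle.

Lemma tau_primes (E : graph) (K : fieldType) (M : set (vertex E)) :
  row_finite E -> max_tails_tau E M ->
  exists F : set (laurent K) -> set (leavitt K E),
  [/\ forall Q, prime_ideal Q -> prime_ideal (F Q) /\ tail_of (F Q) = M,
      forall Q Q', prime_ideal Q -> prime_ideal Q' -> F Q = F Q' -> Q = Q' &
      forall P, prime_ideal P -> tail_of P = M ->
        exists2 Q, prime_ideal Q & F Q = P].
Proof.
move=> rf [mtM ngM].
have [v [e [p [csp pM nex]]]] : exists v e p,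
    [/\ closed_simple_path v e p, path_in M e p & ~ has_exit_in M e p].
  apply: contrapT => no; apply: ngM; split=> // v e p csp pM.
  by apply: contrapT => nex; apply: no; exists v, e, p.
case: csp => ep ev pv sp; case: pM => _ pM.
have wc : walk v (e :: p) by rewrite -ev walk_is_path.
have tc : target v (e :: p) = v by rewrite /target /= last_map.
have ne g f : g \in e :: p -> src f = src g -> M (rng f) -> f = g.
  move=> gp fg Mf; apply: contrapT => fng; apply: nex.
  by exists f; split=> //; exists g.
have Mv : M v by rewrite -ev; case: (pM e); rewrite ?mem_head.
have [outs [uo mo]] := outs_exists M rf.
exists (@lift K E M v outs); split.
- move=> Q prQ; split.
    exact: (@lift_prime K E M v (e :: p)).
  exact: (@lift_tail K E M v (e :: p)).
- exact: (@lift_inj K E M v (e :: p)).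
- exact: (@lift_onto K E M v (e :: p)).
Qed.

(** * The classification *)

Lemma bijective_of_inj_surj (S T : Type) (f : S -> T) :
  injective f -> (forall y, exists x, f x = y) -> bijective f.
Proof. by move=> fI /choice[g fg]; exists g => // x; apply: fI. Qed.

Theorem theorem3p8 (E : graph) (K : fieldType) :
  row_finite E ->
  exists f : max_tails E + max_tails_tau E * SpecStar (laurent K) ->
             Spec (leavitt K E),
    bijective f.
Proof.
move=> rf.
have /choice[G GP] : forall M : set (vertex E), exists P : set (leavitt K E),
    max_tails_gamma E M -> [/\ prime_ideal P, tail_of P = M &
      forall P', prime_ideal P' -> tail_of P' = M -> P' = P].
  move=> M; have [/(gamma_prime K rf)[P PP]|nM] := pselect (max_tails_gamma E M).
    by exists P.
  by exists set0 => /nM.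
have /choice[F FP] : forall M : set (vertex E),
    exists F : set (laurent K) -> set (leavitt K E), max_tails_tau E M ->
    [/\ forall Q, prime_ideal Q -> prime_ideal (F Q) /\ tail_of (F Q) = M,
      forall Q Q', prime_ideal Q -> prime_ideal Q' -> F Q = F Q' -> Q = Q' &
      forall P, prime_ideal P -> tail_of P = M ->
        exists2 Q, prime_ideal Q & F Q = P].
  move=> M; have [/(tau_primes K rf)[H HP]|nM] := pselect (max_tails_tau E M).
    by exists H.
  by exists (fun=> set0) => /nM.
(* Over a tail without the exit condition the primes are a copy of the whole
   spectrum of K[x, x^-1]; the tail itself is sent to the point of the zero ideal. *)
pose base M := if `[< max_tails_gamma E M >] then G M else F M [set 0].
have baseP M : maximal_tail M -> prime_ideal (base M) /\ tail_of (base M) = M.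
  rewrite /base => mtM; case: asboolP => [/GP[]//|ngM].
  have [FM _ _] := FP M (conj mtM ngM); apply: FM; exact: laurent_prime0.
pose ideal_of (s : max_tails E + max_tails_tau E * SpecStar (laurent K)) :=
  match s with inl M => base (val M) | inr (M, Q) => F (val M) (val Q) end.
pose tail (s : max_tails E + max_tails_tau E * SpecStar (laurent K)) :=
  match s with inl M => val M | inr (M, _) => val M end.
have ideal_ofP s : prime_ideal (ideal_of s) /\ tail_of (ideal_of s) = tail s.
  case: s => [M|[M Q]] /=; first exact: baseP (set_valP M).
  have [FM _ _] := FP _ (set_valP M); apply: FM.
  by have [] := set_valP Q.
have /choice[f fE] : forall s, exists P : Spec (leavitt K E), val P = ideal_of s.
  move=> s; have [prP _] := ideal_ofP s.
  by exists (exist _ (ideal_of s) (mem_set prP)).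
exists f; apply: bijective_of_inj_surj => [s s' /(congr1 val)|P].
  rewrite !fE => ss'; have tt : tail s = tail s'.
    by rewrite -(ideal_ofP s).2 -(ideal_ofP s').2 ss'.
  have mixed (M : max_tails E) (N : max_tails_tau E) (Q : SpecStar (laurent K)) :
      val M = val N -> base (val M) <> F (val N) (val Q).
    move=> ->; have [mtN ngN] := set_valP N; rewrite /base; case: asboolP => // _.
    have [_ FI _] := FP _ (set_valP N); have [prQ nQ0] := set_valP Q.
    by move=> /FI e; apply: nQ0; rewrite e //; apply: laurent_prime0.
  case: s s' ss' tt => [M|[M Q]] [M'|[M' Q']] /= ss' MM'.
  - by congr inl; apply: val_inj.
  - by case: (mixed M M' Q').
  - by case: (mixed M' M Q).
  - have MM : M = M' by apply: val_inj.
    subst M'; congr (inr (_, _)); apply: val_inj.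
    have [_ FI _] := FP _ (set_valP M).
    by apply: FI => //; [case: (set_valP Q)|case: (set_valP Q')].
have prP : prime_ideal (val P) := set_valP P.
have mtM := prime_tail rf prP; set M := tail_of (val P) in mtM.
suff [s sP] : exists s, ideal_of s = val P.
  by exists s; apply: val_inj; rewrite fE.
have [gM|ngM] := pselect (max_tails_gamma E M).
  exists (inl (exist _ M (mem_set mtM))); rewrite /= /base; case: asboolP => // _.
  by have [_ _ uniqP] := GP M gM; rewrite -(uniqP _ prP).
have tM : max_tails_tau E M by [].
have [_ _ /(_ _ prP erefl)[Q prQ FQ]] := FP M tM.
have [Q0|nQ0] := pselect (Q = [set 0]).
  exists (inl (exist _ M (mem_set mtM))); rewrite /= /base; case: asboolP => // _.
  by rewrite -Q0.
have sQ : SpecStar (laurent K) Q by [].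
by exists (inr (exist _ M (mem_set tM), exist _ Q (mem_set sQ))).
Qed.
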